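(* Let $\Gamma$ be a torsion-free abelian group and $\rho=(\rho_L,\rho_R):\Gamma\to G\times G$ a faithful representation. Then $\rho$ is admissible if and only if, up to conjugacy in $G\times G$ and up to exchanging the left and right factors, $\rho(\Gamma)$ is a discrete subgroup of one of the groups $A_{hyp}=\{(\exp(\lambda\Delta),\exp(\mu\Delta)):\lambda,\mu\in\mathbb R\}$, $A_{ext}=\{(\exp(\lambda\Delta),\exp(\eta H)):\lambda,\eta\in\mathbb R\}$, $A_{par}=\{(\exp(\lambda H),\exp(\lambda H)):\lambda\in\mathbb R\}$, where $\Delta=\begin{pmatrix}1&0\\0&-1\end{pmatrix}$ and $H=\begin{pmatrix}0&1\\0&0\end{pmatrix}$.
   Context: $G=\mathrm{PSL}(2,\mathbb{R})$, $\widetilde G$ its universal cover, $Z\cong\mathbb Z$ its center generated by $\delta$, $\mathcal Z$ the diagonal image of $Z$ in $\widetilde G\times\widetilde G$. The group $(\widetilde G\times\widetilde G)/\mathcal Z$ is the identity component of the isometry group of $\widetilde{\mathrm{AdS}}\cong\widetilde G$ (acting by $x\mapsto g_Lxg_R^{-1}$) and acts conformally on the conformal boundary $\widehat{\mathrm{Ein}}_2\cong\mathbb R\times S^1$ (conformal class of $d\theta^2-dt^2$), $\delta$ acting as $(t,\theta)\mapsto(t+\pi,\theta+\pi)$. An achronal subset of $\widehat{\mathrm{Ein}}_2$ has no two distinct causally related points; it is generic if it does not contain two points $x,\delta(x)$. $\rho$ is admissible if it is faithful, has discrete image, and lifts to $\tilde\rho:\Gamma\to(\widetilde G\times\widetilde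 G)/\mathcal Z$ preserving a generic closed achronal subset of $\widehat{\mathrm{Ein}}_2$ with at least two points.
   Formalization: ''Achronal'' is taken to mean that no two points are joined by a timelike curve (lightlike related pairs are allowed); forbidding all causally related pairs would make genericity vacuous and the A_ext case false. *)

(* Defs.v *)
From HB Require Import structures.
From mathcomp Require Import all_boot all_order all_algebra.
From mathcomp Require Import Rstruct.
From Stdlib Require Import Reals.
Set Implicit Arguments. Unset Strict Implicit. Unset Printing Implicit Defensive.
Import Order.TTheory GRing.Theory Num.Theory.
Local Open Scope ring_scope.

Definition Mat := 'M[R]_2.
Definition i0 : 'I_2 := @ord0 1.
Definition i1 : 'I_2 := @ord_max 1.

Definition mk (a b c d : R) : Mat :=
  \matrix_(i < 2, j < 2)
     if i == i0 then (if j == i0 then a else b) else (if j == i0 then c else d).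

Definition psl_eq (A B : Mat) : Prop := A = B \/ A = - B.

(* a metric inducing the topology of PSL(2,R) (quotient of SL(2,R) by +-1) *)
Definition mnorm (A : Mat) : R := \sum_(i < 2) \sum_(j < 2) `|A i j|.
Definition psl_dist (A B : Mat) : R := Num.min (mnorm (A - B)) (mnorm (A + B)).

Definition is_psl_rep (Gam : zmodType) (r : Gam -> Mat) : Prop :=
  (forall g, \det (r g) = 1) /\
  (forall a b, psl_eq (r (a + b)) (r a *m r b)).

Definition torsion_free (Gam : zmodType) : Prop :=
  forall (x : Gam) (n : nat), x *+ n.+1 = 0 -> x = 0.

Definition faithful_rep (Gam : zmodType) (rL rR : Gam -> Mat) : Prop :=
  forall g, psl_eq (rL g) 1%:M -> psl_eq (rR g) 1%:M -> g = 0.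

Definition discrete_image (Gam : zmodType) (rL rR : Gam -> Mat) : Prop :=
  forall a, exists eps : R, 0 < eps /\
    forall b, psl_dist (rL b) (rL a) < eps -> psl_dist (rR b) (rR a) < eps ->
      psl_eq (rL b) (rL a) /\ psl_eq (rR b) (rR a).

(* RP^1 = R / pi Z, u |-> the line spanned by (cos u, sin u).
   A lift of the projective action of g on RP^1 is a continuous f : R -> R
   with (cos (f u), sin (f u)) collinear to g (cos u, sin u).
   Elements of tilde G are exactly such lifts (g, f); the centre Z is
   generated by delta acting as u |-> u + pi. *)
Definition proj_lift (g : Mat) (f : R -> R) : Prop :=
  continuity f /\
  forall u : R,
    let w1 := g i0 i0 * cos u + g i0 i1 * sin u in
    let w2 := g i1 i0 * cos u + g i1 i1 * sin u in
    cos (f u) * w2 - sin (f u) * w1 = 0.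

(* \hat Ein_2 = (R x R) / <(pi,pi)>, with lightlike coordinates (u,v) in
   \tilde{RP^1} x \tilde{RP^1}; (g_L,g_R) acts by lifts on u and v resp.
   In the coordinates theta = u + v (mod 2 pi), t = u - v the conformal
   class of d theta^2 - dt^2 = 4 du dv is the given one, (pi,pi) acts
   trivially, and delta = (u,v) |-> (u+pi, v) is (t,theta) |-> (t+pi,theta+pi).
   Subsets of \hat Ein_2 are represented by (pi,pi)-saturated subsets of R x R. *)
Definition saturated (L : R * R -> Prop) : Prop :=
  forall x : R * R, L x <-> L (x.1 + PI, x.2 + PI).

Definition closed2 (L : R * R -> Prop) : Prop :=
  forall x : R * R, ~ L x -> exists eps : R, 0 < eps /\
    forall y : R * R, `|y.1 - x.1| < eps -> `|y.2 - x.2| < eps -> ~ L y.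

(* timelike relation in the universal cover (future: u increases, v decreases) *)
Definition timelike (x y : R * R) : Prop := x.1 < y.1 /\ y.2 < x.2.

(* for a saturated set this says no two points of the corresponding subset of
   \hat Ein_2 are joined by a timelike curve *)
Definition achronal (L : R * R -> Prop) : Prop :=
  forall x y, L x -> L y -> ~ timelike x y.

Definition generic (L : R * R -> Prop) : Prop :=
  forall x, L x -> ~ L (x.1 + PI, x.2).

Definition two_points (L : R * R -> Prop) : Prop :=
  exists x y, L x /\ L y /\
    forall k : Z, y <> (x.1 + IZR k * PI, x.2 + IZR k * PI).

(* rho lifts to a homomorphism tilde rho : Gamma -> (tilde G x tilde G)/Z *)
Definition is_lift (Gam : zmodType) (rL rR : Gam -> Mat)
    (FL FR : Gam -> R -> R) : Prop :=
  (forall g, proj_lift (rL g) (FL g) /\ proj_lift (rR g) (FR g)) /\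
  (forall a b, exists k : Z, forall u : R,
      FL (a + b) u = FL a (FL b u) + IZR k * PI /\
      FR (a + b) u = FR a (FR b u) + IZR k * PI).

Definition admissible (Gam : zmodType) (rL rR : Gam -> Mat) : Prop :=
  faithful_rep rL rR /\ discrete_image rL rR /\
  exists (FL FR : Gam -> R -> R), is_lift rL rR FL FR /\
  exists L : R * R -> Prop,
    saturated L /\ closed2 L /\ achronal L /\ generic L /\ two_points L /\
    (forall g x, L x -> L (FL g x.1, FR g x.2)).

Definition expDelta (l : R) : Mat := mk (exp l) 0 0 (exp (- l)).
Definition expH (e : R) : Mat := mk 1 e 0 1.

Definition inAhyp (A B : Mat) : Prop :=
  exists l m : R, psl_eq A (expDelta l) /\ psl_eq B (expDelta m).
Definition inAext (A B : Mat) : Prop :=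
  exists l e : R, psl_eq A (expDelta l) /\ psl_eq B (expH e).
Definition inApar (A B : Mat) : Prop :=
  exists l : R, psl_eq A (expH l) /\ psl_eq B (expH l).

Definition conjm (P A : Mat) : Mat := P *m A *m invmx P.

Definition in_model (Gam : zmodType) (rL rR : Gam -> Mat)
    (S : Mat -> Mat -> Prop) : Prop :=
  exists P Q : Mat, \det P = 1 /\ \det Q = 1 /\
    ((forall g, S (conjm P (rL g)) (conjm Q (rR g))) \/
     (forall g, S (conjm Q (rR g)) (conjm P (rL g)))).

(* Main.v *)
(* Work with the projective lifts f of a matrix A: the set of lines fixed by A is the zero set of det (e(u), A e(u)), and when A is not elliptic it has a unique lift fixing points, whose displacement has the sign of that determinant.

A saturated achronal set L stays within bounded distance of the diagonals of R^2. Hence if (f, h) preserves L and h has a fixed point, the f-orbits in L are bounded, and f has a fixed point too: the two components of rho(g) are both elliptic or both non-elliptic, and in the latter case L is invariant under the two canonical lifts. Both elliptic is impossible: by simultaneous Dirichlet approximation some nontrivial power of rho(g) is arbitrarily close to 1, against discreteness. So each factor is, up to conjugacy, diagonal or unipotent. In the unipotent-unipotent case with parameters (a, b), an element with a > 0 > b pushes every point of L towards a fixed point in opposite directions forwards and backwards; the limits are in L, and genericity forces L to be a single orbit of Z. Thus a b >= 0 on the whole group, which forces b to be a positive multiple of a unless one of them vanishes.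

Conversely, in the first two models L is the Z-orbit of two common fixed points, and in the third it is the graph of a lift of the matrix conjugating the two factors. *)
Require Import Defs.
From HB Require Import structures.
From mathcomp Require Import all_boot all_order all_algebra.
From mathcomp Require Import Rstruct.
From Stdlib Require Import Reals Lia Classical.
From mathcomp Require Import ring lra.
Import Order.TTheory GRing.Theory Num.Theory.
Local Open Scope ring_scope.
Bind Scope ring_scope with R.
Arguments sin _%_ring_scope.
Arguments cos _%_ring_scope.
Arguments atan _%_ring_scope.
Arguments acos _%_ring_scope.
Arguments exp _%_ring_scope.
Arguments ln _%_ring_scope.

(** * Multiples of [PI], intermediate values and continuity *)

Lemma pi_gt0 : 0 < PI :> R.
Proof. exact/RltP/PI_RGT_0. Qed.

Lemma cossq_sinsq (x : R) : cos x * cos x + sin x * sin x = 1.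
Proof. by move: (sin2_cos2 x); rewrite /Rsqr !RealsE addrC. Qed.

Lemma IZRD (m n : Z) : IZR (m + n) = IZR m + IZR n.
Proof. exact: plus_IZR. Qed.

Lemma IZRN (m : Z) : IZR (- m) = - IZR m.
Proof. exact: opp_IZR. Qed.

Lemma IZR_pi_lt (m n : Z) : IZR m * PI < IZR n * PI -> (m + 1 <= n)%Z.
Proof. by rewrite ltr_pM2r ?pi_gt0// => /RltP/lt_IZR; lia. Qed.

Lemma IZR_pi_inj (m n : Z) : IZR m * PI = IZR n * PI -> m = n.
Proof. by move=> /(mulIf (lt0r_neq0 pi_gt0))/eq_IZR. Qed.

Lemma IZR_mono (m n : Z) : (m <= n)%Z -> IZR m <= IZR n.
Proof. by move=> h; apply/RleP/IZR_le. Qed.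

Lemma IZR_pi_le (m n : Z) : (m <= n)%Z -> IZR m * PI <= IZR n * PI.
Proof. by move=> h; rewrite ler_pM2r ?pi_gt0// IZR_mono. Qed.

Lemma sin_eq0_Z (x : R) : sin x = 0 -> exists k : Z, x = IZR k * PI.
Proof. exact: sin_eq_0_0. Qed.

Lemma sin_Zpi (k : Z) : sin (IZR k * PI) = 0.
Proof. by apply: sin_eq_0_1; exists k. Qed.

(** The sign [s] is kept opaque: [s * s = 1] already shows that expressions quadratic in [cos] and
    [sin] are [PI]-periodic, with no case split on the parity of [k]. *)
Lemma cos_sin_addZ (u : R) (k : Z) : let s := cos (IZR k * PI) in
  [/\ s * s = 1, cos (u + IZR k * PI) = s * cos u &
      sin (u + IZR k * PI) = s * sin u].
Proof.
move=> s; have := cossq_sinsq (IZR k * PI).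
rewrite cosD sinD sin_Zpi -/s => h.
by split; [move: h|..]; rewrite ?(mulr0, mul0r, addr0, subr0)// mulrC.
Qed.

Lemma ivt (f : R -> R) (x y : R) : continuity f -> x <= y -> f x * f y <= 0 ->
  exists2 z, x <= z <= y & f z = 0.
Proof.
move=> cf /RleP xy /RleP fxy.
have [z [[/RleP h1 /RleP h2] fz]] := IVT_cor f x y cf xy fxy.
by exists z => //; rewrite h1.
Qed.

Lemma ivt_any (f : R -> R) (x y : R) : continuity f -> f x <= 0 -> 0 <= f y ->
  exists z, f z = 0.
Proof.
move=> cf fx fy; have [xy|/ltW xy] := leP x y.
  by have [|z _ fz] := ivt f x y cf xy; [nra|exists z].
by have [|z _ fz] := ivt f y x cf xy; [nra|exists z].
Qed.

Lemma continuityD (f g : R -> R) :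
  continuity f -> continuity g -> continuity (fun x => f x + g x).
Proof. exact: continuity_plus. Qed.

Lemma continuityB (f g : R -> R) :
  continuity f -> continuity g -> continuity (fun x => f x - g x).
Proof. exact: continuity_minus. Qed.

Lemma continuityM (f g : R -> R) :
  continuity f -> continuity g -> continuity (fun x => f x * g x).
Proof. exact: continuity_mult. Qed.

Lemma continuity_cst (c : R) : continuity (fun=> c).
Proof. by apply: continuity_const => x y. Qed.

Lemma continuity_id : continuity (fun x => x).
Proof. exact: derivable_continuous derivable_id. Qed.

Lemma continuity_circ (f g : R -> R) :
  continuity f -> continuity g -> continuity (fun x => f (g x)).
Proof. by move=> cf cg; exact: (continuity_comp g f). Qed.

(** Two different values would make [h] cross a half-odd multiple of [PI], which is not an integer
    multiple. *)
Lemma continuous_Zpi_constant (h : R -> R) : continuity h ->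
  (forall u, exists k : Z, h u = IZR k * PI) ->
  exists k : Z, forall u, h u = IZR k * PI.
Proof.
move=> ch hZ; have [k0 h0] := hZ 0; exists k0 => u.
have [k hu] := hZ u.
have [<-//|kk0] : k = k0 \/ k <> k0 by lia.
have half (c : R) (m : Z) z : h z - (c * PI) = 0 -> c = IZR m + 2^-1 -> False.
  have [n ->] := hZ z => /eqP; rewrite subr_eq0 => /eqP.
  move=> /(mulIf (lt0r_neq0 pi_gt0)) <- e.
  have /eq_IZR : IZR (n + n) = IZR (m + m + 1) by rewrite !IZRD R1E e; lra.
  by lia.
have pi0 := pi_gt0.
have cc c : continuity (fun x => h x - c) by apply: continuityB => //; exact: continuity_cst.
have [lt|lt] : (k0 + 1 <= k)%Z \/ (k + 1 <= k0)%Z by lia.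
- have /IZR_pi_le := lt; rewrite IZRD R1E => {}lt.
  have [||z hz] := ivt_any (fun x => h x - (IZR k0 + 2^-1) * PI) 0 u (cc _).
  + by rewrite h0; lra.
  + by rewrite hu; lra.
  by case: (half _ _ _ hz erefl).
- have /IZR_pi_le := lt; rewrite IZRD R1E => {}lt.
  have [||z hz] := ivt_any (fun x => h x - (IZR k + 2^-1) * PI) u 0 (cc _).
  + by rewrite hu; lra.
  + by rewrite h0; lra.
  by case: (half _ _ _ hz erefl).
Qed.

(** * Projective lifts *)

Lemma det2 (A : Mat) : \det A = A i0 i0 * A i1 i1 - A i0 i1 * A i1 i0 :> R.
Proof.
rewrite (expand_det_row A i0) !big_ord_recl big_ord0 addr0 /cofactor.
rewrite !det_mx11 !mxE /= expr0 expr1 mul1r mulN1r mulrN.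
by congr (A _ _ * A _ _ - A _ _ * A _ _); apply: val_inj.
Qed.

Lemma mx2P (A B : Mat) : A i0 i0 = B i0 i0 -> A i0 i1 = B i0 i1 ->
  A i1 i0 = B i1 i0 -> A i1 i1 = B i1 i1 -> A = B.
Proof.
move=> h00 h01 h10 h11; apply/matrixP => i j.
have ord2 (k : 'I_2) : k = i0 \/ k = i1.
  by case: k => [[|[|//]]] p; [left|right]; apply: val_inj.
by case: (ord2 i) => ->; case: (ord2 j) => ->.
Qed.

Lemma mulmx2 (A B : Mat) i j : (A *m B) i j = A i i0 * B i0 j + A i i1 * B i1 j.
Proof.
rewrite mxE !big_ord_recl big_ord0 addr0.
by congr (A _ _ * B _ _ + A _ _ * B _ _); apply: val_inj.
Qed.

Lemma mk00 a b c d : mk a b c d i0 i0 = a. Proof. by rewrite mxE. Qed.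
Lemma mk01 a b c d : mk a b c d i0 i1 = b. Proof. by rewrite mxE. Qed.
Lemma mk10 a b c d : mk a b c d i1 i0 = c. Proof. by rewrite mxE. Qed.
Lemma mk11 a b c d : mk a b c d i1 i1 = d. Proof. by rewrite mxE. Qed.
Definition mkE := (mk00, mk01, mk10, mk11).

Lemma one00 : (1%:M : Mat) i0 i0 = 1. Proof. by rewrite mxE. Qed.
Lemma one01 : (1%:M : Mat) i0 i1 = 0. Proof. by rewrite mxE. Qed.
Lemma one10 : (1%:M : Mat) i1 i0 = 0. Proof. by rewrite mxE. Qed.
Lemma one11 : (1%:M : Mat) i1 i1 = 1. Proof. by rewrite mxE. Qed.
Definition oneE := (one00, one01, one10, one11).

Lemma oppmx2 (A : Mat) i j : (- A) i j = - A i j. Proof. by rewrite mxE. Qed.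

Definition mx2E := (mulmx2, mkE, oneE, oppmx2).

Lemma det_opp (A : Mat) : \det (- A) = \det A :> R.
Proof. by rewrite !det2 !mx2E; ring. Qed.

Lemma psl_refl A : psl_eq A A. Proof. by left. Qed.

Lemma psl_sym A B : psl_eq A B -> psl_eq B A.
Proof. by case=> ->; [left|right; rewrite opprK]. Qed.

Lemma psl_trans A B C : psl_eq A B -> psl_eq B C -> psl_eq A C.
Proof. by case=> -> [] ->; [left|right|right|left; rewrite opprK]. Qed.

Lemma psl_mul A B C D : psl_eq A B -> psl_eq C D -> psl_eq (A *m C) (B *m D).
Proof.
by case=> -> [] ->; rewrite ?(mulmxN, mulNmx) ?opprK; [left|right|right|left].
Qed.

Lemma psl_det A B : psl_eq A B -> \det A = \det B :> R.
Proof. by case=> -> //; rewrite det_opp. Qed.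

Definition w1 (A : Mat) (u : R) : R := A i0 i0 * cos u + A i0 i1 * sin u.
Definition w2 (A : Mat) (u : R) : R := A i1 i0 * cos u + A i1 i1 * sin u.

(* With e(u) = (cos u, sin u), turn A u = det (e(u), A e(u)): it vanishes iff A fixes the line u, and its sign is the direction in which A turns that line. *)
Definition turn A u := cos u * w2 A u - sin u * w1 A u.

(** The scalar is the inner product of A e(u) with e(f u). If it were zero, A e(u), being collinear
    to e(f u), would vanish, and inverting A would give e(u) = 0. *)
Lemma proj_lift_vec A f : \det A = 1 -> proj_lift A f -> forall u,
  exists2 s, s != 0 & w1 A u = s * cos (f u) /\ w2 A u = s * sin (f u).
Proof.
rewrite det2 => dA [_ lf] u; have := lf u; rewrite /= -/(w1 A u) -/(w2 A u) => e.
have c := cossq_sinsq (f u).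
exists (w1 A u * cos (f u) + w2 A u * sin (f u)); last first.
  set C := cos (f u) in e c *; set S := sin (f u) in e c *.
  split.
  - have -> : (w1 A u * C + w2 A u * S) * C =
      w1 A u * (C * C + S * S) + S * (C * w2 A u - S * w1 A u) by ring.
    by rewrite c e; ring.
  - have -> : (w1 A u * C + w2 A u * S) * S =
      w2 A u * (C * C + S * S) - C * (C * w2 A u - S * w1 A u) by ring.
    by rewrite c e; ring.
apply/eqP => s0.
have h1 : w1 A u = 0.
  transitivity ((w1 A u * cos (f u) + w2 A u * sin (f u)) * cos (f u) - (cos (f u) * w2 A u - sin (f u) * w1 A u) * sin (f u)).
    by transitivity (w1 A u * (cos (f u) * cos (f u) + sin (f u) * sin (f u))); [rewrite c|]; ring.
  by rewrite s0 e; ring.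
have h2 : w2 A u = 0.
  transitivity ((w1 A u * cos (f u) + w2 A u * sin (f u)) * sin (f u) + (cos (f u) * w2 A u - sin (f u) * w1 A u) * cos (f u)).
    by transitivity (w2 A u * (cos (f u) * cos (f u) + sin (f u) * sin (f u))); [rewrite c|]; ring.
  by rewrite s0 e; ring.
have hc : cos u = A i1 i1 * w1 A u - A i0 i1 * w2 A u.
  by rewrite /w1 /w2; transitivity ((A i0 i0 * A i1 i1 - A i0 i1 * A i1 i0) * cos u); [rewrite dA|]; ring.
have hs : sin u = A i0 i0 * w2 A u - A i1 i0 * w1 A u.
  by rewrite /w1 /w2; transitivity ((A i0 i0 * A i1 i1 - A i0 i1 * A i1 i0) * sin u); [rewrite dA|]; ring.
by have := cossq_sinsq u; rewrite hc hs h1 h2; lra.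
Qed.

(** Since B e(u) = s e(h u), the collinearity condition for [A *m B] at [u] is [s] times the
    condition for [A] at [h u]. *)
Lemma proj_lift_mul A B f h : \det B = 1 -> proj_lift A f -> proj_lift B h ->
  proj_lift (A *m B) (fun u => f (h u)).
Proof.
move=> dB lf lh; split; first exact: continuity_circ lf.1 lh.1.
move=> u /=; have [s _ [h1 h2]] := proj_lift_vec B h dB lh u.
have := lf.2 (h u); rewrite /= => e; rewrite !mx2E.
move: h1 h2; rewrite /w1 /w2 => h1 h2.
set v := h u in h1 h2 e *.
transitivity (cos (f v) * (A i1 i0 * (B i0 i0 * cos u + B i0 i1 * sin u) + A i1 i1 * (B i1 i0 * cos u + B i1 i1 * sin u)) - sin (f v) * (A i0 i0 * (B i0 i0 * cos u + B i0 i1 * sin u) + A i0 i1 * (B i1 i0 * cos u + B i1 i1 * sin u))); first ring.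
rewrite h1 h2; transitivity (s * (cos (f v) * (A i1 i0 * cos v + A i1 i1 * sin v) - sin (f v) * (A i0 i0 * cos v + A i0 i1 * sin v))); first ring.
by rewrite e mulr0.
Qed.

Lemma proj_lift_psl A B f : psl_eq A B -> proj_lift A f -> proj_lift B f.
Proof.
move=> /psl_sym[] -> // [cf lf]; split=> // u; have := lf u.
by rewrite /= !mx2E => e; move: e; lra.
Qed.

Lemma turn_psl A B u : psl_eq A B -> turn A u = 0 -> turn B u = 0.
Proof. by move=> /psl_sym[] ->; rewrite // /turn /w1 /w2 !mx2E; lra. Qed.

(** Both values are angles of the line of A e(u), so their difference is continuous with values in
    the multiples of [PI]. *)
Lemma proj_lift_uniq A f g : \det A = 1 -> proj_lift A f -> proj_lift A g ->
  exists k : Z, forall u, f u = g u + IZR k * PI.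
Proof.
move=> dA lf lg.
have [||k hk] := continuous_Zpi_constant (fun u => f u - g u).
- exact: continuityB lf.1 lg.1.
- move=> u; apply: sin_eq0_Z.
  have [s s0 [h1 h2]] := proj_lift_vec A f dA lf u.
  have := lg.2 u; rewrite /= -/(w1 A u) -/(w2 A u) h1 h2 => e.
  rewrite sinD cos_neg sin_neg RoppE; apply: (mulfI s0); rewrite mulr0 -[RHS]e; ring.
by exists k => u; rewrite -(hk u); ring.
Qed.

Lemma turn_eq0_of_lift A f u (k : Z) : proj_lift A f ->
  f u = u + IZR k * PI -> turn A u = 0.
Proof.
move=> [_ lf] fu; have := lf u; rewrite /= -/(w1 A u) -/(w2 A u) fu.
have [ss -> ->] := cos_sin_addZ u k => e.
move: e; set s := cos (IZR k * PI) in ss *; rewrite /turn => e.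
rewrite -[LHS]mul1r -ss.
transitivity (s * (s * cos u * w2 A u - s * sin u * w1 A u)); first ring.
by rewrite e mulr0.
Qed.

(** * The canonical lift *)

(** Together with [turn A u], the coordinates of A e(u) in the orthonormal frame e(u), e(u +
    pi/2). *)
Definition radial A u := cos u * w1 A u + sin u * w2 A u.

Lemma radial_turn A u :
  radial A u * radial A u + turn A u * turn A u = w1 A u * w1 A u + w2 A u * w2 A u.
Proof.
rewrite /radial /turn.
transitivity ((cos u * cos u + sin u * sin u) * (w1 A u * w1 A u + w2 A u * w2 A u)); first by ring.
by rewrite cossq_sinsq mul1r.
Qed.

Definition speed A u := sqrt (w1 A u * w1 A u + w2 A u * w2 A u).

Lemma sumsq_ge0 (x y : R) : 0 <= x * x + y * y.
Proof. by rewrite -!expr2 addr_ge0 ?sqr_ge0. Qed.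

Lemma speed_sq A u : speed A u * speed A u = w1 A u * w1 A u + w2 A u * w2 A u.
Proof. by rewrite /speed; apply: sqrt_sqrt; apply/RleP/sumsq_ge0. Qed.

Lemma speed_ge0 A u : 0 <= speed A u.
Proof. by apply/RleP; exact: sqrt_pos. Qed.

(* Otherwise A e(u) = - speed * e(u), so the eigenvalues of A would be negative. *)
Lemma speed_radial_gt0 A u : \det A = 1 -> 0 <= A i0 i0 + A i1 i1 ->
  0 < speed A u + radial A u.
Proof.
rewrite det2 => dA tA; have := speed_sq A u; rewrite -radial_turn.
have := speed_ge0 A u; set n := speed A u; set p := radial A u => n0 hn.
have [t0|t0] := eqVneq (turn A u) 0; last first.
  have : 0 < turn A u * turn A u by rewrite lt0r mulf_neq0//= -expr2 sqr_ge0.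
  move=> tt; rewrite ltNge; apply/negP => np.
  have : (n + p) * (n - p) <= 0 by apply: mulr_le0_ge0 => //; lra.
  by nra.
suff : 0 < p by lra.
(* [p] and [q] are the diagonal entries of A in the frame e(u), e(u + pi/2), where A is triangular
   because [turn A u = 0]. Hence [p + q] is the trace and [p * q] the determinant. *)
pose q := sin u * (A i0 i0 * sin u - A i0 i1 * cos u) + cos u * (A i1 i1 * cos u - A i1 i0 * sin u).
have cs := cossq_sinsq u.
have pq : p + q = A i0 i0 + A i1 i1.
  transitivity ((cos u * cos u + sin u * sin u) * (A i0 i0 + A i1 i1)).
    by rewrite /p /q /radial /w1 /w2; ring.
  by rewrite cs mul1r.
have pq1 : p * q = 1.
  rewrite -dA; transitivity ((cos u * cos u + sin u * sin u) * (cos u * cos u + sin u * sin u) * (A i0 i0 * A i1 i1 - A i0 i1 * A i1 i0) + turn A u * (cos u * (- A i0 i0 * sin u + A i0 i1 * cos u) + sin u * (- A i1 i0 * sin u + A i1 i1 * cos u))).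
    by rewrite /p /q /radial /turn /w1 /w2; ring.
  by rewrite t0 cs; ring.
by nra.
Qed.

Definition angle A u := 2 * atan (turn A u / (speed A u + radial A u)).

(* The half-angle formula for the angle in (-pi, pi) from e(u) to A e(u). *)
Definition angle_lift A u := u + angle A u.

Lemma IZR2 : IZR 2 = 2 :> R.
Proof. by rewrite IZRposE INRE. Qed.

Lemma angle_eq0 A u : turn A u = 0 -> angle A u = 0.
Proof. by rewrite /angle => ->; rewrite mul0r atan_0 mulr0. Qed.

Lemma angle_gt0 A u : \det A = 1 -> 0 <= A i0 i0 + A i1 i1 ->
  0 < turn A u -> 0 < angle A u.
Proof.
move=> dA tA t0; have d0 := speed_radial_gt0 A u dA tA.
have : 0 < turn A u / (speed A u + radial A u) by rewrite divr_gt0.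
by rewrite /angle => /RltP/atan_increasing; rewrite atan_0 => /RltP h; rewrite pmulr_rgt0.
Qed.

Lemma angle_lt0 A u : \det A = 1 -> 0 <= A i0 i0 + A i1 i1 ->
  turn A u < 0 -> angle A u < 0.
Proof.
move=> dA tA t0; have d0 := speed_radial_gt0 A u dA tA.
have : turn A u / (speed A u + radial A u) < 0 by rewrite pmulr_llt0 ?invr_gt0.
by rewrite /angle => /RltP/atan_increasing; rewrite atan_0 => /RltP h; rewrite pmulr_rlt0.
Qed.

Lemma continuity_w1 A : continuity (w1 A).
Proof.
apply: continuityD; (apply: continuityM; first exact: continuity_cst).
  exact: continuity_cos.
exact: continuity_sin.
Qed.

Lemma continuity_w2 A : continuity (w2 A).
Proof.
apply: continuityD; (apply: continuityM; first exact: continuity_cst).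
  exact: continuity_cos.
exact: continuity_sin.
Qed.

Lemma continuity_angle_lift A : \det A = 1 -> 0 <= A i0 i0 + A i1 i1 ->
  continuity (angle_lift A).
Proof.
move=> dA tA; apply: continuityD; first exact: continuity_id.
apply: continuityM; first exact: continuity_cst.
apply: continuity_circ.
  by move=> x; apply: derivable_continuous_pt; exact: derivable_pt_atan.
have c1 := continuity_w1 A; have c2 := continuity_w2 A.
have cc := continuity_cos; have cs := continuity_sin.
have ct : continuity (turn A) by apply: continuityB; apply: continuityM.
have cd : continuity (fun x => speed A x + radial A x).
  apply: continuityD; last by apply: continuityD; apply: continuityM.
  move=> x; apply: (continuity_pt_comp _ sqrt).
    by apply: continuityD; apply: continuityM.
  by apply: continuity_pt_sqrt; apply/RleP/sumsq_ge0.
move=> x; apply: (continuity_pt_div (turn A) _ x (ct x) (cd x)).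
by apply/eqP; apply: lt0r_neq0; exact: speed_radial_gt0.
Qed.

Lemma proj_lift_angle_lift A : \det A = 1 -> 0 <= A i0 i0 + A i1 i1 ->
  proj_lift A (angle_lift A).
Proof.
move=> dA tA; split; first exact: continuity_angle_lift.
move=> u; rewrite -/(w1 A u) -/(w2 A u) /= /angle_lift /angle.
have D0 := speed_radial_gt0 A u dA tA.
have nn := speed_sq A u; rewrite -radial_turn in nn.
set D := speed A u + radial A u in D0 *.
set x := atan _.
have hS : D * sin x = turn A u * cos x.
  have : cos x <> 0.
    have [/RltP + /RltP] := atan_bound (turn A u / D).
    rewrite -/x !RdivE RoppE IZR2 => x1 x2 c0.
    have : Rlt 0 (cos x) by apply: cos_gt_0; apply/RltP; rewrite ?RoppE RdivE IZR2; lra.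
    by rewrite c0 => /RltP; rewrite ltxx.
  move=> /eqP c0; have := tan_atan (turn A u / D); rewrite -/x /tan RdivE => e.
  have -> : turn A u = D * (sin x / cos x) by rewrite e mulrC divfK// lt0r_neq0.
  by rewrite -mulrA divfK.
have -> : 2 * x = x + x by ring.
rewrite !(cosD, sinD); set C := cos x in hS *; set S := sin x in hS *.
(* Collinearity of e(u + 2x) with A e(u), written in the frame at [u] by the double-angle
   formulas. *)
transitivity ((C * C - S * S) * turn A u - 2 * S * C * radial A u).
  by rewrite /turn /radial; ring.
have D0' := lt0r_neq0 D0.
apply: (mulfI D0'); apply: (mulfI D0'); rewrite !mulr0.
transitivity ((D * C) * (D * C) * turn A u - (D * S) * (D * S) * turn A u - 2 * (D * S) * (D * C) * radial A u); first by ring.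
rewrite hS.
(* Once [D * S] is replaced by [turn A u * C], the remaining factor is Pythagoras for A e(u). *)
transitivity (turn A u * C * C * (speed A u * speed A u - (radial A u * radial A u + turn A u * turn A u))); last by rewrite nn subrr mulr0.
by rewrite /D; ring.
Qed.

Lemma turn_addZ A u (k : Z) : turn A (u + IZR k * PI) = turn A u.
Proof.
rewrite /turn /w1 /w2; have [ss -> ->] := cos_sin_addZ u k.
rewrite -[RHS]mul1r -ss; ring.
Qed.

Lemma angle_addZ A u (k : Z) : angle A (u + IZR k * PI) = angle A u.
Proof.
rewrite /angle turn_addZ /speed /radial /w1 /w2.
have [ss -> ->] := cos_sin_addZ u k; set s := cos (IZR k * PI) in ss *.
congr (2 * atan (_ / (sqrt _ + _))).
- by rewrite -[RHS]mul1r -ss; ring.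
- by rewrite -[RHS]mul1r -ss; ring.
Qed.

Lemma angle_lift_addZ A u (k : Z) : angle_lift A (u + IZR k * PI) = angle_lift A u + IZR k * PI.
Proof. by rewrite /angle_lift angle_addZ; ring. Qed.

(** Of the two representatives of a class, one of nonnegative trace: there the denominator in
    [angle] is positive. *)
Definition posrep (A : Mat) : Mat := if 0 <= A i0 i0 + A i1 i1 then A else - A.

Lemma posrep_psl A : psl_eq (posrep A) A.
Proof. by rewrite /posrep; case: ifP => _; [left|right]. Qed.

Lemma posrep_det A : \det A = 1 -> \det (posrep A) = 1.
Proof. by rewrite (psl_det _ _ (posrep_psl A)). Qed.

Lemma posrep_tr A : 0 <= posrep A i0 i0 + posrep A i1 i1.
Proof. by rewrite /posrep; case: ifP => // /negbT; rewrite -ltNge !mx2E; lra. Qed.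

(** When A fixes a line, this is the unique lift with fixed points. *)
Definition canlift A := angle_lift (posrep A).

Lemma proj_lift_canlift A : \det A = 1 -> proj_lift A (canlift A).
Proof.
move=> dA; apply: proj_lift_psl (posrep_psl A) _.
by apply: proj_lift_angle_lift; [exact: posrep_det|exact: posrep_tr].
Qed.

Lemma canlift_fix A u : turn A u = 0 -> canlift A u = u.
Proof.
move=> tu; rewrite /canlift /angle_lift angle_eq0 ?addr0//.
by apply: turn_psl tu; apply: psl_sym; exact: posrep_psl.
Qed.

Lemma proj_lift_addZ A f u (k : Z) : \det A = 1 -> proj_lift A f ->
  f (u + IZR k * PI) = f u + IZR k * PI.
Proof.
move=> dA lf; have [m hm] := proj_lift_uniq A f (canlift A) dA lf (proj_lift_canlift A dA).
by rewrite !hm /canlift angle_lift_addZ; ring.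
Qed.

(** The determinant of A e(v) and A e(u) is [sin (u - v)]. If [f u = f v], both vectors lie on one
    line, so [u - v] is a multiple of [PI], and equivariance makes that multiple 0. *)
Lemma proj_lift_inj A f : \det A = 1 -> proj_lift A f -> injective f.
Proof.
move=> dA lf u v fuv.
suff /sin_eq0_Z[k hk] : sin (u - v) = 0.
  have uv : u = v + IZR k * PI by rewrite -hk; ring.
  move: fuv; rewrite uv (proj_lift_addZ A f)// => /(canRL (addKr _)).
  by rewrite addNr => ->; rewrite addr0.
have [s s0 [h1 h2]] := proj_lift_vec A f dA lf u.
have [r r0 [h3 h4]] := proj_lift_vec A f dA lf v.
move: h1 h2 h3 h4; rewrite fuv; set C := cos (f v); set S := sin (f v) => h1 h2 h3 h4.
have : w1 A v * w2 A u - w2 A v * w1 A u = 0 by rewrite h1 h2 h3 h4; ring.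
move: dA; rewrite det2 => dA; rewrite /w1 /w2 => e.
rewrite sinD cos_neg sin_neg RoppE -[LHS]mul1r -dA -[RHS]e; ring.
Qed.

(** If [f v <= f u] with [u < v], then [f] climbs above [f u] again at some [u + n PI] beyond [v],
    so it takes the value [f u] twice, against injectivity. *)
Lemma proj_lift_incr A f : \det A = 1 -> proj_lift A f ->
  forall u v : R, u < v -> f u < f v.
Proof.
move=> dA lf u v uv; rewrite ltNge; apply/negP => fvu.
have fi := proj_lift_inj A f dA lf.
have [n [vn n0]] : exists n : Z, v < u + IZR n * PI /\ (0 < n)%Z.
  have [/RltP h1 _] := archimed ((v - u) / PI).
  exists (up ((v - u) / PI)); have pi0 := pi_gt0; split.
    by move: h1; rewrite ltr_pdivrMr//; lra.
  apply: lt_IZR; apply/RltP; apply: lt_trans h1.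
  by apply: divr_gt0 => //; lra.
have [|||w /andP[vw _] fw] := ivt (fun x => f x - f u) v (u + IZR n * PI).
- by apply: continuityB; [exact: lf.1|exact: continuity_cst].
- exact: ltW.
- rewrite (proj_lift_addZ A f)//.
  have /IZR_pi_le : (0 <= n)%Z by lia.
  by rewrite mul0r; nra.
have /fi wu : f w = f u by apply/eqP; rewrite -subr_eq0 fw.
by move: uv; rewrite -wu; lra.
Qed.

(** * Admissibility of the models *)

Lemma proj_lift_eq A f g w : \det A = 1 -> proj_lift A f -> proj_lift A g ->
  f w = g w -> forall u, f u = g u.
Proof.
move=> dA lf lg fw u; have [k hk] := proj_lift_uniq A f g dA lf lg.
by rewrite hk; have := hk w; rewrite fw; lra.
Qed.

(** Both composites lift [A *m M], so they differ by a constant multiple of [PI]. Evaluated at [w]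
    this shows that A fixes the line [h w]; then both composites agree at [w], hence everywhere. *)
Lemma canlift_intertwine A A' M h w : \det A = 1 -> \det A' = 1 -> \det M = 1 ->
  psl_eq (A *m M) (M *m A') -> proj_lift M h -> turn A' w = 0 ->
  turn A (h w) = 0 /\ forall u, canlift A (h u) = h (canlift A' u).
Proof.
move=> dA dA' dM AM lh tw.
have dAM : \det (A *m M) = 1 by rewrite det_mulmx dA dM mulr1.
have l1 : proj_lift (A *m M) (fun u => canlift A (h u)).
  by apply: proj_lift_mul => //; exact: proj_lift_canlift.
have l2 : proj_lift (A *m M) (fun u => h (canlift A' u)).
  apply: proj_lift_psl (psl_sym _ _ AM) _.
  by apply: proj_lift_mul => //; exact: proj_lift_canlift.
have [k hk] := proj_lift_uniq _ _ _ dAM l1 l2.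
have thw : turn A (h w) = 0.
  apply: (turn_eq0_of_lift A (canlift A) _ k); first exact: proj_lift_canlift.
  by rewrite hk (canlift_fix A').
split=> //; apply: (proj_lift_eq _ _ _ w dAM l1 l2).
by rewrite !canlift_fix.
Qed.

(** A common fixed point removes the ambiguity by multiples of [PI]: both sides are lifts fixing
    [w]. *)
Lemma canlift_morph (Gam : zmodType) (r : Gam -> Mat) w : is_psl_rep r ->
  (forall g, turn (r g) w = 0) ->
  forall a b u, canlift (r (a + b)) u = canlift (r a) (canlift (r b) u).
Proof.
move=> [dr rD] tw a b.
apply: (proj_lift_eq (r (a + b)) _ _ w) => //; first exact: proj_lift_canlift.
- apply: proj_lift_psl (psl_sym _ _ (rD a b)) _.
  by apply: proj_lift_mul => //; exact: proj_lift_canlift.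
- by rewrite !canlift_fix.
Qed.

Lemma is_lift_canlift (Gam : zmodType) (rL rR : Gam -> Mat) u v :
  is_psl_rep rL -> is_psl_rep rR ->
  (forall g, turn (rL g) u = 0) -> (forall g, turn (rR g) v = 0) ->
  is_lift rL rR (fun g => canlift (rL g)) (fun g => canlift (rR g)).
Proof.
move=> hL hR tL tR; split=> [g|a b].
  by split; apply: proj_lift_canlift; [apply: hL.1|apply: hR.1].
exists 0%Z => x; rewrite (canlift_morph _ rL u)// (canlift_morph _ rR v)//.
by rewrite R0E mul0r !addr0.
Qed.

Lemma invmxK2 (P : Mat) : \det P = 1 -> P *m invmx P = 1%:M /\ invmx P *m P = 1%:M.
Proof.
move=> dP; have uP : P \in unitmx by rewrite unitmxE dP unitr1.
by rewrite mulmxV// mulVmx.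
Qed.

Lemma det_invmx1 (P : Mat) : \det P = 1 -> \det (invmx P) = 1.
Proof. by rewrite det_inv => ->; rewrite invr1. Qed.

Lemma conjm_swap P A A' : \det P = 1 -> psl_eq (conjm P A) A' ->
  psl_eq (A *m invmx P) (invmx P *m A').
Proof.
move=> dP h; have [h1 h2] := invmxK2 P dP.
have -> : A *m invmx P = invmx P *m conjm P A.
  by rewrite /conjm !mulmxA h2 mul1mx.
by apply: psl_mul => //; exact: psl_refl.
Qed.

Lemma det_conjm P A : \det P = 1 -> \det (conjm P A) = \det A :> R.
Proof. by move=> dP; rewrite /conjm !det_mulmx det_inv dP invr1 mulr1 mul1r. Qed.

Lemma turn_conjm P A A' w : \det P = 1 -> \det A = 1 -> psl_eq (conjm P A) A' ->
  turn A' w = 0 -> turn A (canlift (invmx P) w) = 0.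
Proof.
move=> dP dA e tw; have dI := det_invmx1 P dP.
apply: (proj1 (canlift_intertwine A A' (invmx P) _ w _ _ _ _ _ _)) => //.
- by rewrite -(psl_det _ _ e) det_conjm.
- exact: conjm_swap.
- exact: proj_lift_canlift.
Qed.

Lemma turn_expDelta0 l : turn (expDelta l) 0 = 0.
Proof. by rewrite /turn /w1 /w2 !mkE cos_0 sin_0 !RealsE; ring. Qed.

Lemma turn_expDelta1 l : turn (expDelta l) (PI / 2) = 0.
Proof.
rewrite /turn /w1 /w2 !mkE.
have := cos_PI2; rewrite RdivE IZR2 => ->; have := sin_PI2; rewrite RdivE IZR2 => ->.
by rewrite !RealsE; ring.
Qed.

Lemma turn_expH e : turn (expH e) 0 = 0.
Proof. by rewrite /turn /w1 /w2 !mkE cos_0 sin_0 !RealsE; ring. Qed.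

Lemma sin_norm_le (x : R) : `|sin x| <= `|x|.
Proof.
suff pos (y : R) : 0 < y -> `|sin y| <= y.
  have [x0|x0|->] := ltgtP x 0.
  - by have := pos (- x); rewrite sin_neg RoppE normrN oppr_gt0 (ltr0_norm x0); apply.
  - by rewrite (gtr0_norm x0); exact: pos.
  - by rewrite sin_0 normr0.
move=> y0; have /RltP/ltW sy := sin_lt_x y (elimT RltP y0).
rewrite ler_norml sy andbT.
have [yp|py] := leP y PI.
  have /RleP := sin_ge_0 y (elimT RleP (ltW y0)) (elimT RleP yp).
  by move=> s0; apply: le_trans s0; rewrite oppr_le0 ltW.
have s1 : -1 <= sin y by apply/RleP; exact: (SIN_bound y).1.
have IZR3 : IZR 3 = 3 :> R by rewrite IZRposE INRE.
by have /RltP := PI2_3_2; rewrite !RdivE IZR2 IZR3; lra.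
Qed.

Lemma sin_lipschitz (x y : R) : `|sin x - sin y| <= `|x - y|.
Proof.
have -> : sin x - sin y = 2 * cos ((x + y) / 2) * sin ((x - y) / 2).
  by rewrite -IZR2; exact: form4.
have c1 : `|cos ((x + y) / 2)| <= 1.
  by rewrite ler_norml; apply/andP; split; apply/RleP; have [] := COS_bound ((x + y) / 2).
have s1 := sin_norm_le ((x - y) / 2).
rewrite !normrM (ger0_norm (x := 2))// -mulrA.
have n2 : `|(x - y) / 2| = `|x - y| / 2 by rewrite normrM (ger0_norm (x := 2^-1))//; lra.
rewrite n2 in s1.
have : `|cos ((x + y) / 2)| * `|sin ((x - y) / 2)| <= 1 * (`|x - y| / 2) by apply: ler_pM.
by lra.
Qed.

Lemma continuity_eps (f : R -> R) (x e : R) : continuity f -> 0 < e ->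
  exists2 d, 0 < d & forall y, `|y - x| < d -> `|f y - f x| < e.
Proof.
move=> cf /RltP e0; have [d [d0 hd]] := cf x e e0.
exists d; first exact/RltP.
move=> y yx; have [->|/eqP ne] := eqVneq y x.
  by rewrite subrr normr0; exact/RltP.
by apply/RltP; apply: hd; split; [split=> //; exact: not_eq_sym|exact/RltP].
Qed.

(** The preimage in the plane of a single point of the conformal boundary. *)
Definition orbitZ (p x : R * R) := exists k : Z, x = (p.1 + IZR k * PI, p.2 + IZR k * PI).

(** A point off the orbit either lies on another line [x.1 - x.2 = const], at positive distance, or
    on the same line, where [|sin (x.1 - p.1)|] bounds the distance to the orbit from below. *)
Lemma closed_orbitZ p : closed2 (orbitZ p).
Proof.
move=> x nx; pose e := `|(x.1 - x.2) - (p.1 - p.2)|.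
have [e0|e0] := eqVneq e 0; last first.
  have e1 : 0 < e by rewrite lt0r e0 /= normr_ge0.
  exists (e / 2); split; first by lra.
  move=> y y1 y2 [k yk]; suff : e < e by rewrite ltxx.
  have : e = `|(x.1 - y.1) - (x.2 - y.2)| by rewrite /e yk /=; congr `|_|; ring.
  have := ler_normB (x.1 - y.1) (x.2 - y.2).
  by rewrite (distrC x.1) (distrC x.2); lra.
have s0 : sin (x.1 - p.1) != 0.
  apply/eqP => /sin_eq0_Z[k hk]; apply: nx; exists k; rewrite -hk.
  have /normr0_eq0 := e0 => xp.
  by rewrite [LHS]surjective_pairing; congr (_, _); lra.
exists `|sin (x.1 - p.1)|; split; first by rewrite normr_gt0.
move=> y y1 _ [k yk]; have := sin_lipschitz (y.1 - p.1) (x.1 - p.1).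
have -> : y.1 - p.1 = IZR k * PI by rewrite yk /=; ring.
rewrite sin_Zpi sub0r normrN.
have -> : IZR k * PI - (x.1 - p.1) = y.1 - x.1 by rewrite yk /=; ring.
by rewrite leNgt y1.
Qed.

Lemma closed2U L1 L2 : closed2 L1 -> closed2 L2 -> closed2 (fun x => L1 x \/ L2 x).
Proof.
move=> c1 c2 x nx.
have [|e1 [e10 h1]] := c1 x; first by move=> ?; apply: nx; left.
have [|e2 [e20 h2]] := c2 x; first by move=> ?; apply: nx; right.
exists (Num.min e1 e2); split; first by rewrite lt_min e10.
move=> y; rewrite !lt_min => /andP[y1 y1'] /andP[y2 y2'] [].
  exact: h1.
exact: h2.
Qed.

(** The invariant set is the union of the two orbits of common fixed points. The inequalities are
    weak on the left so that the points may share a coordinate, as when one factor is parabolic. *)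
Lemma admissible_two_fixed (Gam : zmodType) (rL rR : Gam -> Mat) (u0 u1 v0 v1 : R) :
  is_psl_rep rL -> is_psl_rep rR -> faithful_rep rL rR -> discrete_image rL rR ->
  u0 <= u1 < u0 + PI -> v0 <= v1 < v0 + PI -> (u0, v0) <> (u1, v1) ->
  (forall g, turn (rL g) u0 = 0 /\ turn (rL g) u1 = 0) ->
  (forall g, turn (rR g) v0 = 0 /\ turn (rR g) v1 = 0) ->
  admissible rL rR.
Proof.
move=> hL hR fa di /andP[u01 u10] /andP[v01 v10] ne tL tR; split=> //; split=> //.
exists (fun g => canlift (rL g)), (fun g => canlift (rR g)); split.
  by apply: (is_lift_canlift _ _ _ u0 v0) => // g; [have [] := tL g|have [] := tR g].
have pi0 := pi_gt0.
exists (fun x => orbitZ (u0, v0) x \/ orbitZ (u1, v1) x); split.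
  have orb p x : orbitZ p x <-> orbitZ p (x.1 + PI, x.2 + PI).
    split=> [[k ->]|[k [h1 h2]]].
      by exists (k + 1)%Z; rewrite IZRD R1E /=; congr (_, _); ring.
    exists (k - 1)%Z; rewrite IZRD IZRN R1E [LHS]surjective_pairing.
    by congr (_, _); [rewrite -(addrK PI x.1) h1|rewrite -(addrK PI x.2) h2]; ring.
  by move=> x; rewrite -!orb.
split; first by apply: closed2U; exact: closed_orbitZ.
have step (m n : Z) : (m + 1 <= n)%Z -> IZR m * PI + PI <= IZR n * PI.
  by move=> /IZR_pi_le; rewrite IZRD R1E; lra.
have key (a b : R) (k l : Z) : a + IZR k * PI < b + IZR l * PI -> b <= a + PI -> (k <= l)%Z.
  move=> h1 h2; have [//|/step] : (k <= l)%Z \/ (l + 1 <= k)%Z by lia.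
  by lra.
have key2 (a b : R) (k l : Z) : a + IZR k * PI < b + IZR l * PI -> b <= a -> (k + 1 <= l)%Z.
  by move=> h1 h2; apply: IZR_pi_lt; lra.
split.
  (* A timelike pair would force opposite inequalities between the indices [k] and [l], at least one
     of them strict. *)
  move=> x y [] [k ->] [] [l ->] [/= h1 h2].
  - have := key2 _ _ _ _ h1 (lexx _); have := key2 _ _ _ _ h2 (lexx _); lia.
  - have := key _ _ _ _ h1 (ltW u10); have := key2 _ _ _ _ h2 v01; lia.
  - have := key2 _ _ _ _ h1 u01; have := key _ _ _ _ h2 (ltW v10); lia.
  - have := key2 _ _ _ _ h1 (lexx _); have := key2 _ _ _ _ h2 (lexx _); lia.
split.
  have same (a : R) (k l : Z) : a + IZR k * PI = a + IZR l * PI -> k = l.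
    by move=> /addrI/IZR_pi_inj.
  have near (a b : R) (k l : Z) : a <= b < a + PI -> a + IZR k * PI = b + IZR l * PI -> k = l.
    move=> /andP[ab ba] e; apply: Z.le_antisymm.
      have [//|/step] : (k <= l)%Z \/ (l + 1 <= k)%Z by lia.
      by lra.
    have [//|/step] : (l <= k)%Z \/ (k + 1 <= l)%Z by lia.
    by lra.
  have pE (a : R) (k : Z) : a + IZR k * PI + PI = a + IZR (k + 1) * PI.
    by rewrite IZRD R1E; ring.
  (* The central translation raises the index read off the first coordinate by one and leaves that
     of the second, whereas both must equal [l]. *)
  move=> x [] [k ->] [] [l /= [h1 h2]]; rewrite pE in h1.
  - by have := same _ _ _ h1; have := same _ _ _ h2; lia.
  - by have := near _ _ _ _ _ h1; have := near _ _ _ _ _ h2; rewrite u01 v01 => /(_ v10) + /(_ u10); lia.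
  - by have := near _ _ _ _ _ (esym h1); have := near _ _ _ _ _ (esym h2); rewrite u01 v01 => /(_ v10) + /(_ u10); lia.
  - by have := same _ _ _ h1; have := same _ _ _ h2; lia.
split.
  exists (u0, v0), (u1, v1); split; [|split].
  - by left; exists 0%Z; rewrite R0E mul0r !addr0.
  - by right; exists 0%Z; rewrite R0E mul0r !addr0.
  move=> k [/= h1 h2]; apply: ne.
  have k0 : k = 0%Z.
    have [//|[/step|/step]] : k = 0%Z \/ (0 + 1 <= k)%Z \/ (k + 1 <= 0)%Z by lia.
      by rewrite R0E mul0r => ?; exfalso; lra.
    by rewrite R0E mul0r => ?; exfalso; lra.
  by rewrite h1 h2 k0 R0E mul0r !addr0.
have fixZ A u (k : Z) : turn A u = 0 -> canlift A (u + IZR k * PI) = u + IZR k * PI.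
  by move=> tu; rewrite canlift_fix// turn_addZ.
move=> g x [] [k ->] /=; have [t1 t2] := tL g; have [t3 t4] := tR g.
- by left; exists k; rewrite !fixZ.
- by right; exists k; rewrite !fixZ.
Qed.

(** The two axes, at angles 0 and pi/2, are carried back by a lift of [invmx P]; monotonicity and
    equivariance of the lift keep them within one period. *)
Lemma fixed_expDelta (Gam : zmodType) (r : Gam -> Mat) P : is_psl_rep r ->
  \det P = 1 -> (forall g, exists l, psl_eq (conjm P (r g)) (expDelta l)) ->
  exists u0 u1, u0 < u1 < u0 + PI /\ forall g, turn (r g) u0 = 0 /\ turn (r g) u1 = 0.
Proof.
move=> [dr _] dP h; have pi0 := pi_gt0.
have dI := det_invmx1 P dP; have li := proj_lift_canlift _ dI.
exists (canlift (invmx P) 0), (canlift (invmx P) (PI / 2)); split.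
  apply/andP; split.
    by apply: (proj_lift_incr _ _ dI li); lra.
  have := proj_lift_addZ _ _ 0 1 dI li; rewrite R1E mul1r => <-.
  by apply: (proj_lift_incr _ _ dI li); lra.
move=> g; have [l hl] := h g; split; apply: (turn_conjm _ _ _ _ _ _ hl) => //.
  exact: turn_expDelta0.
exact: turn_expDelta1.
Qed.

Lemma fixed_expH (Gam : zmodType) (r : Gam -> Mat) P : is_psl_rep r ->
  \det P = 1 -> (forall g, exists e, psl_eq (conjm P (r g)) (expH e)) ->
  exists u, forall g, turn (r g) u = 0.
Proof.
move=> [dr _] dP h; exists (canlift (invmx P) 0) => g; have [e he] := h g.
by apply: (turn_conjm _ _ _ _ _ _ he) => //; exact: turn_expH.
Qed.

(** The invariant set is the graph of a lift [h] of [M]: achronal since [h] increases, generic since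
    [h (x + PI) = h x + PI], invariant since [h] intertwines the canonical lifts. *)
Lemma admissible_of_conj (Gam : zmodType) (rL rR : Gam -> Mat) M u :
  is_psl_rep rL -> is_psl_rep rR -> faithful_rep rL rR -> discrete_image rL rR ->
  \det M = 1 -> (forall g, psl_eq (rR g *m M) (M *m rL g)) ->
  (forall g, turn (rL g) u = 0) -> admissible rL rR.
Proof.
move=> hL hR fa di dM hM tu; split=> //; split=> //.
have lM := proj_lift_canlift M dM; set h := canlift M in lM.
have hh g : turn (rR g) (h u) = 0 /\ forall x, canlift (rR g) (h x) = h (canlift (rL g) x).
  by apply: (canlift_intertwine _ _ M) => //; [exact: hR.1|exact: hL.1].
exists (fun g => canlift (rL g)), (fun g => canlift (rR g)); split.
  by apply: (is_lift_canlift _ _ _ u (h u)) => // g; have [] := hh g.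
have hpi x : h (x + PI) = h x + PI.
  by have := proj_lift_addZ _ _ x 1 dM lM; rewrite R1E mul1r.
exists (fun x => x.2 = h x.1); split.
  by move=> x /=; rewrite hpi; split=> [->//|/addIr].
split.
  move=> x /eqP; rewrite -subr_eq0 -normr_gt0; set e := `|_| => e0.
  have [||d d0 hd] := continuity_eps h x.1 (e / 2); [exact: lM.1|lra|].
  exists (Num.min d (e / 2)); split; first by rewrite lt_min d0; lra.
  move=> y; rewrite !lt_min => /andP[/hd h1 _] /andP[_ h2] yh.
  suff : e < e by rewrite ltxx.
  have : e = `|(x.2 - y.2) + (h y.1 - h x.1)| by rewrite /e yh; congr `|_|; ring.
  have := ler_normD (x.2 - y.2) (h y.1 - h x.1).
  by rewrite (distrC x.2); lra.
have hi := proj_lift_incr M h dM lM; have pi0 := pi_gt0.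
split; first by move=> x y /= hx hy [/hi]; rewrite -hx -hy; lra.
split; first by move=> x /= hx; rewrite hpi -hx; lra.
split.
  exists (0, h 0), (PI / 2, h (PI / 2)); do 2!split=> //.
  move=> k [/= e _].
  have : IZR 1 = IZR (2 * k).
    apply: (mulIf (lt0r_neq0 pi0)); rewrite mult_IZR RmultE IZR2 R1E.
    by move: e; rewrite add0r; lra.
  by move=> /eq_IZR; lia.
by move=> g x /= ->; rewrite (hh g).2.
Qed.

Lemma admissible_of_model (Gam : zmodType) (rL rR : Gam -> Mat) :
  is_psl_rep rL -> is_psl_rep rR -> faithful_rep rL rR -> discrete_image rL rR ->
  in_model rL rR inAhyp \/ in_model rL rR inAext \/ in_model rL rR inApar ->
  admissible rL rR.
Proof.
move=> hL hR fa di; have pi0 := pi_gt0.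
have hyp P Q : \det P = 1 -> \det Q = 1 ->
    (forall g, exists l, psl_eq (conjm P (rL g)) (expDelta l)) ->
    (forall g, exists l, psl_eq (conjm Q (rR g)) (expDelta l)) -> admissible rL rR.
  move=> dP dQ eL eR.
  have [u0 [u1 [/andP[u01 u10] tu]]] := fixed_expDelta _ _ P hL dP eL.
  have [v0 [v1 [/andP[v01 v10] tv]]] := fixed_expDelta _ _ Q hR dQ eR.
  apply: (admissible_two_fixed _ _ _ u0 u1 v0 v1) => //.
  - by rewrite (ltW u01).
  - by rewrite (ltW v01).
  - by move=> [e]; move: u01; rewrite e ltxx.
have par P Q : \det P = 1 -> \det Q = 1 ->
    (forall g, inApar (conjm P (rL g)) (conjm Q (rR g))) -> admissible rL rR.
  move=> dP dQ e.
  have [|u tu] := fixed_expH _ _ P hL dP.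
    by move=> g; have [l [h _]] := e g; exists l.
  (* Both factors are conjugate to the same [expH l], by [P] and by [Q], so this product conjugates
     one to the other. *)
  apply: (admissible_of_conj _ _ _ (invmx Q *m P) u) => //.
    by rewrite det_mulmx det_invmx1// dP mulr1.
  move=> g; have [l [h1 h2]] := e g.
  have [_ PI] := invmxK2 P dP.
  have h3 := psl_mul _ _ _ _ (conjm_swap _ _ _ dQ h2) (psl_refl P).
  rewrite mulmxA; apply: psl_trans h3 _; rewrite -!mulmxA.
  apply: psl_mul; first exact: psl_refl.
  apply: psl_sym; have := psl_mul _ _ _ _ h1 (psl_refl P).
  by rewrite /conjm -!mulmxA PI mulmx1.
case=> [|[]] [P [Q [dP [dQ [] h]]]].
- by apply: (hyp P Q) => // g; have [l [m [h1 h2]]] := h g; [exists l|exists m].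
- by apply: (hyp P Q) => // g; have [l [m [h1 h2]]] := h g; [exists m|exists l].
- have [|u0 [u1 [/andP[u01 u10] tu]]] := fixed_expDelta _ _ P hL dP.
    by move=> g; have [l [m [h1 h2]]] := h g; exists l.
  have [|v tv] := fixed_expH _ _ Q hR dQ.
    by move=> g; have [l [m [h1 h2]]] := h g; exists m.
  (* The unipotent factor supplies one fixed line, paired with both fixed lines of the diagonal
     factor. *)
  apply: (admissible_two_fixed _ _ _ u0 u1 v v) => //.
  + by rewrite (ltW u01).
  + by rewrite lexx; lra.
  + by move=> [e]; move: u01; rewrite e ltxx.
- have [|v0 [v1 [/andP[v01 v10] tv]]] := fixed_expDelta _ _ Q hR dQ.
    by move=> g; have [l [m [h1 h2]]] := h g; exists l.
  have [|u tu] := fixed_expH _ _ P hL dP.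
    by move=> g; have [l [m [h1 h2]]] := h g; exists m.
  apply: (admissible_two_fixed _ _ _ u u v0 v1) => //.
  + by rewrite lexx; lra.
  + by rewrite (ltW v01).
  + by move=> [e]; move: v01; rewrite e ltxx.
- exact: (par P Q).
- by apply: (par P Q) => // g; have [l [h1 h2]] := h g; exists l.
Qed.

(** * Dynamics on invariant achronal sets *)

Lemma Un_cv_shift (U : nat -> R) l : Un_cv U l -> Un_cv (fun n => U n.+1) l.
Proof.
move=> cU e e0; have [N hN] := cU e e0; exists N => n nN.
by apply: hN; apply: le_S.
Qed.

(** The orbit is monotone in the direction of its first step, so it converges, and continuity makes
    the limit fixed. The last two clauses record on which side of [u] it lies. *)
Lemma orbit_cv (f : R -> R) (u m M : R) : continuity f ->
  (forall x y : R, x <= y -> f x <= f y) -> (forall n, m <= iter n f u <= M) ->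
  exists l, [/\ Un_cv (fun n => iter n f u) l, f l = l,
                (u <= f u -> u <= l) & (f u <= u -> l <= u)].
Proof.
move=> cf fi bd.
have fixl l : Un_cv (fun n => iter n f u) l -> f l = l.
  move=> cl; apply: UL_sequence (Un_cv_shift _ _ cl).
  exact: (continuity_seq f (fun n => iter n f u) l (cf l) cl).
have [ufu|/ltW fuu] := leP u (f u).
- have gr : Un_growing (fun n => iter n f u).
    by move=> n; apply/RleP; elim: n => //= n; exact: fi.
  have [|l cl] := growing_cv _ gr.
    by exists M => _ [n ->]; apply/RleP; have /andP[] := bd n.
  have ul : u <= l by apply/RleP; exact: (growing_ineq _ _ gr cl 0%N).
  exists l; split=> // [|fuu]; first exact: fixl.
  have e : f u = u by apply/eqP; rewrite eq_le fuu.
  have : Un_cv (fun=> u) l.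
    by move: cl; apply: Un_cv_ext => n; elim: n => //= n ->.
  move=> /(UL_sequence _ _ u) ->; first exact: lexx.
  by move=> eps e0; exists 0%N => n _; rewrite /Rdist Rminus_diag Rabs_R0.
- have gr : Un_decreasing (fun n => iter n f u).
    by move=> n; apply/RleP; elim: n => //= n; exact: fi.
  have [|l cl] := decreasing_cv _ gr.
    by exists (- m) => _ [n ->]; apply/RleP; rewrite /opp_seq RoppE lerN2; have /andP[] := bd n.
  have lu : l <= u by apply/RleP; exact: (decreasing_ineq _ _ gr cl 0%N).
  by exists l; split=> //; exact: fixl.
Qed.

Lemma closed2_cv L (a b : nat -> R) l m : closed2 L ->
  (forall n, L (a n, b n)) -> Un_cv a l -> Un_cv b m -> L (l, m).
Proof.
move=> cL Lab ca cb; apply: NNPP => /cL[e [/RltP e0 he]].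
have [N1 h1] := ca e e0; have [N2 h2] := cb e e0.
apply: (he (a (N1 + N2)%coq_nat, b (N1 + N2)%coq_nat)) => //=; apply/RltP.
- by apply: h1; lia.
- by apply: h2; lia.
Qed.

Lemma saturatedZ L (k : Z) x : saturated L -> L x ->
  L (x.1 + IZR k * PI, x.2 + IZR k * PI).
Proof.
move=> sL Lx.
pose P (m : Z) := L (x.1 + IZR m * PI, x.2 + IZR m * PI).
apply: (Z.peano_ind P); rewrite /P.
- by rewrite R0E mul0r !addr0 -surjective_pairing.
- move=> m /sL; rewrite -Z.add_1_r IZRD R1E /=.
  by congr L; congr (_, _); ring.
- move=> m h; apply/sL; move: h; rewrite -Z.sub_1_r IZRD IZRN R1E /=.
  by congr L; congr (_, _); ring.
Qed.

Lemma below_modZ (y z : R) : exists k : Z, z - PI <= y + IZR k * PI < z.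
Proof.
have pi0 := pi_gt0; pose r := (y - z) / PI.
have rE : r * PI = y - z by rewrite /r divfK// lt0r_neq0.
have [/RltP h1 /RleP h2] := archimed r; exists (- up r)%Z.
move: h1 h2; rewrite IZRN RminusE R1E; set n := IZR _ => h1 h2.
by apply/andP; split; nra.
Qed.

(** Translate [y] so that its first coordinate falls in [[x.1 - PI, x.1)]. If the bound failed, its
    second coordinate would exceed [x.2], giving a timelike pair. *)
Lemma achronal_width L x y : saturated L -> achronal L -> L x -> L y ->
  (x.1 - x.2) - (y.1 - y.2) <= PI.
Proof.
move=> sL aL Lx Ly; rewrite leNgt; apply/negP => lt.
have [k /andP[k1 k2]] := below_modZ y.1 x.1.
by apply: (aL _ _ (saturatedZ _ k _ sL Ly) Lx); split=> /=; lra.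
Qed.

Lemma iter_fix_ge (h : R -> R) p v n : (forall x y : R, x <= y -> h x <= h y) ->
  h p = p -> p <= v -> p <= iter n h v.
Proof. by move=> hi hp pv; elim: n => //= n /hi; rewrite hp. Qed.

Lemma iter_fix_le (h : R -> R) p v n : (forall x y : R, x <= y -> h x <= h y) ->
  h p = p -> v <= p -> iter n h v <= p.
Proof. by move=> hi hp pv; elim: n => //= n /hi; rewrite hp. Qed.

(** The translates of [w] by multiples of [PI] are fixed too, and two consecutive ones trap the
    orbit of [v]. *)
Lemma iter_fix_bound (h : R -> R) w v : (forall x y : R, x <= y -> h x <= h y) ->
  (forall (x : R) (k : Z), h (x + IZR k * PI) = h x + IZR k * PI) -> h w = w ->
  exists m : R, forall n, m <= iter n h v <= m + PI.
Proof.
move=> hi hZ hw; have [k /andP[k1 k2]] := below_modZ w v.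
exists (w + IZR k * PI) => n; apply/andP; split.
  by apply: iter_fix_ge; rewrite ?hZ ?hw//; exact: ltW.
apply: iter_fix_le => //; last by lra.
have -> : w + IZR k * PI + PI = w + IZR (k + 1) * PI by rewrite IZRD R1E; ring.
by rewrite hZ hw.
Qed.

Lemma iter_inv L (f h : R -> R) x n : (forall y, L y -> L (f y.1, h y.2)) ->
  L x -> L (iter n f x.1, iter n h x.2).
Proof.
move=> inv Lx; elim: n => [|n /inv//]; first by rewrite -surjective_pairing.
Qed.

(* L stays within bounded distance of a diagonal, so a bounded h-orbit forces the f-orbit to be bounded. *)
Lemma fixed_transfer L (f h : R -> R) x v : saturated L -> achronal L -> L x ->
  (forall y, L y -> L (f y.1, h y.2)) -> continuity f ->
  (forall x y : R, x <= y -> f x <= f y) -> (forall x y : R, x <= y -> h x <= h y) ->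
  (forall (x : R) (k : Z), h (x + IZR k * PI) = h x + IZR k * PI) -> h v = v ->
  exists u, f u = u.
Proof.
move=> sL aL Lx inv cf fi hi hZ hv.
have [m hm] := iter_fix_bound h v x.2 hi hZ hv.
have [|l [_ fl _ _]] := orbit_cv f x.1 (m + (x.1 - x.2) - PI) (m + PI + (x.1 - x.2) + PI) cf fi.
  move=> n; have Ln := iter_inv L f h x n inv Lx.
  have := achronal_width L _ _ sL aL Ln Lx.
  have := achronal_width L _ _ sL aL Lx Ln; have /andP[/=] := hm n.
  by move=> *; apply/andP; split; lra.
by exists l.
Qed.

Lemma proj_lift_mono A f : \det A = 1 -> proj_lift A f ->
  forall x y : R, x <= y -> f x <= f y.
Proof.
move=> dA lf x y; rewrite le_eqVlt => /orP[/eqP->//|xy].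
by apply/ltW/(proj_lift_incr A f).
Qed.

(** [F] and [H] differ from the canonical lifts by [k PI] and [m PI], and saturation absorbs [m].
    The map [canlift A] shifted by [(k - m) PI] inherits a fixed point from [canlift B], so A fixes
    a line and the shift is zero. *)
Lemma canlift_normalize A B F H L x v : \det A = 1 -> \det B = 1 ->
  proj_lift A F -> proj_lift B H -> saturated L -> achronal L -> L x ->
  (forall y, L y -> L (F y.1, H y.2)) -> turn B v = 0 ->
  (exists u, turn A u = 0) /\ forall y, L y -> L (canlift A y.1, canlift B y.2).
Proof.
move=> dA dB lF lH sL aL Lx inv tv.
have lA := proj_lift_canlift A dA; have lB := proj_lift_canlift B dB.
have [k hk] := proj_lift_uniq A F _ dA lF lA.
have [m hm] := proj_lift_uniq B H _ dB lH lB.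
pose f (y : R) : R := canlift A y + IZR (k - m) * PI.
have inv' y : L y -> L (f y.1, canlift B y.2).
  move=> /inv/(saturatedZ _ (- m) _ sL) /=; rewrite hk hm /f IZRD IZRN.
  by congr L; congr (_, _); ring.
have [|||||u fu] := fixed_transfer L f (canlift B) x v sL aL Lx inv'.
- by apply: continuityD; [exact: lA.1|exact: continuity_cst].
- by move=> y z /(proj_lift_mono _ _ dA lA) ?; rewrite lerD2r.
- exact: proj_lift_mono lB.
- by move=> y j; exact: (proj_lift_addZ B).
- exact: canlift_fix.
have tu : turn A u = 0.
  apply: (turn_eq0_of_lift A (canlift A) u (m - k)%Z) => //.
  by rewrite -[in RHS]fu /f !IZRD !IZRN; ring.
split; first by exists u.
have km : IZR (k - m) * PI = 0 by move: fu; rewrite /f canlift_fix//; lra.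
by move=> y /inv'; rewrite /f km addr0.
Qed.

(** If [q > p], compare [y] with the translate of [x] by [p + 1]: for [q = p + 1] it is the image of
    [y] under the center, against genericity, and for larger [q] it is timelike related to [y].
    Exchanging [x] and [y] treats [q < p]. *)
Lemma generic_lattice L x y (p q : Z) : saturated L -> achronal L -> generic L ->
  L x -> L y -> y.1 = x.1 + IZR p * PI -> y.2 = x.2 + IZR q * PI -> p = q.
Proof.
move=> sL aL gL; have pi0 := pi_gt0.
have main x' y' (p' q' : Z) : L x' -> L y' -> y'.1 = x'.1 + IZR p' * PI ->
    y'.2 = x'.2 + IZR q' * PI -> (q' <= p')%Z.
  move=> Lx Ly e1 e2.
  have [//|pq] : (q' <= p')%Z \/ (p' + 1 <= q')%Z by lia.
  have Lz := saturatedZ L (p' + 1) _ sL Lx.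
  have [qE|pq2] : q' = (p' + 1)%Z \/ (p' + 1 + 1 <= q')%Z by lia.
    case: (gL _ Ly); move: Lz; congr L; rewrite e1 e2 qE IZRD R1E.
    by congr (_, _); ring.
  case: (aL _ _ Ly Lz); split; rewrite /= ?e1 ?e2; first by rewrite IZRD R1E; lra.
  by have /IZR_pi_le := pq2; rewrite !IZRD R1E; lra.
move=> Lx Ly e1 e2; have := main _ _ _ _ Lx Ly e1 e2.
suff : (- q <= - p)%Z by lia.
by apply: (main _ _ _ _ Ly Lx); rewrite IZRN ?e1 ?e2; ring.
Qed.

(** Meant for an element, acting by [(f, h)], and its inverse, acting by [(f', h')]. [Z1] and [Z2]
    contain the fixed points of each factor and form at most one orbit of translations by [PI]. *)
Lemma opposite_dynamics L (f h f' h' : R -> R) (Z1 Z2 : R -> Prop) u0 v0 u1 v1 :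
  saturated L -> closed2 L -> achronal L -> generic L ->
  continuity f -> continuity h -> continuity f' -> continuity h' ->
  (forall x y : R, x <= y -> f x <= f y) -> (forall x y : R, x <= y -> h x <= h y) ->
  (forall x y : R, x <= y -> f' x <= f' y) -> (forall x y : R, x <= y -> h' x <= h' y) ->
  (forall (x : R) (k : Z), f (x + IZR k * PI) = f x + IZR k * PI) ->
  (forall (x : R) (k : Z), h (x + IZR k * PI) = h x + IZR k * PI) ->
  (forall (x : R) (k : Z), f' (x + IZR k * PI) = f' x + IZR k * PI) ->
  (forall (x : R) (k : Z), h' (x + IZR k * PI) = h' x + IZR k * PI) ->
  f u0 = u0 -> h v0 = v0 -> f' u1 = u1 -> h' v1 = v1 ->
  (forall x : R, f x <= x) -> (forall x : R, x <= h x) ->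
  (forall x : R, x <= f' x) -> (forall x : R, h' x <= x) ->
  (forall x, f x = x -> Z1 x) -> (forall x, f' x = x -> Z1 x) ->
  (forall x, h x = x -> Z2 x) -> (forall x, h' x = x -> Z2 x) ->
  (forall x y, Z1 x -> Z1 y -> exists k : Z, y = x + IZR k * PI) ->
  (forall x y, Z2 x -> Z2 y -> exists k : Z, y = x + IZR k * PI) ->
  (forall y, L y -> L (f y.1, h y.2)) -> (forall y, L y -> L (f' y.1, h' y.2)) ->
  ~ two_points L.
Proof.
move=> sL cL aL gL cf ch cf' ch' fi hi fi' hi' fZ hZ fZ' hZ' fu0 hv0 fu1 hv1.
move=> fle hge fge hle Zf Zf' Zh Zh' Z1d Z2d inv inv'.
have lim F H u v x : continuity F -> continuity H ->
    (forall x y : R, x <= y -> F x <= F y) -> (forall x y : R, x <= y -> H x <= H y) ->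
    (forall (x : R) (k : Z), F (x + IZR k * PI) = F x + IZR k * PI) ->
    (forall (x : R) (k : Z), H (x + IZR k * PI) = H x + IZR k * PI) ->
    F u = u -> H v = v -> (forall y, L y -> L (F y.1, H y.2)) -> L x ->
    exists l m, [/\ L (l, m), F l = l, H m = m,
      (x.1 <= F x.1 -> x.1 <= l) /\ (F x.1 <= x.1 -> l <= x.1) &
      (x.2 <= H x.2 -> x.2 <= m) /\ (H x.2 <= x.2 -> m <= x.2)].
  move=> cF cH Fi Hi FZ HZ Fu Hv invF Lx.
  have [a ha] := iter_fix_bound F u x.1 Fi FZ Fu.
  have [b hb] := iter_fix_bound H v x.2 Hi HZ Hv.
  have [l [cl Fl l1 l2]] := orbit_cv F x.1 _ _ cF Fi ha.
  have [m [cm Hm m1 m2]] := orbit_cv H x.2 _ _ cH Hi hb.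
  exists l, m; split=> //.
  apply: (closed2_cv L _ _ l m cL _ cl cm) => n.
  exact: iter_inv.
have inZ x : L x -> Z1 x.1 /\ Z2 x.2.
  move=> Lx.
  have [l [m [Llm fl hm [_ /(_ (fle _)) l1] [/(_ (hge _)) m1 _]]]] :=
    lim f h u0 v0 x cf ch fi hi fZ hZ fu0 hv0 inv Lx.
  have [r [s [Lrs fr hs [/(_ (fge _)) r1 _] [_ /(_ (hle _)) s1]]]] :=
    lim f' h' u1 v1 x cf' ch' fi' hi' fZ' hZ' fu1 hv1 inv' Lx.
  have [p hp] := Z1d _ _ (Zf _ fl) (Zf' _ fr).
  have [q hq] := Z2d _ _ (Zh _ hm) (Zh' _ hs).
  have pq := generic_lattice L (l, m) (r, s) p q sL aL gL Llm Lrs hp hq.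
  rewrite pq in hp.
  (* The backward limit minus the forward one is the same multiple of [PI] in both coordinates,
     nonnegative in the first and nonpositive in the second. So it is zero, and [x] is squeezed onto
     the limit. *)
  have -> : x.1 = l by apply/eqP; rewrite eq_le l1 andbT; lra.
  have -> : x.2 = m by apply/eqP; rewrite eq_le m1 /=; lra.
  by split; [exact: Zf|exact: Zh].
move=> [x [y [Lx [Ly ne]]]].
have [x1 x2] := inZ x Lx; have [y1 y2] := inZ y Ly.
have [p hp] := Z1d _ _ x1 y1; have [q hq] := Z2d _ _ x2 y2.
have pq := generic_lattice L x y p q sL aL gL Lx Ly hp hq.
by apply: (ne p); rewrite [LHS]surjective_pairing hp hq pq.
Qed.

(** * Elliptic elements *)

(** The vector (x, 1) spans a fixed line iff [c * x * x + (d - a) * x - b = 0], whose discriminant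
    is the squared trace minus 4. *)
Lemma exists_turn_eq0 (A : Mat) : \det A = 1 ->
  4 <= (A i0 i0 + A i1 i1) * (A i0 i0 + A i1 i1) -> exists u, turn A u = 0.
Proof.
rewrite det2 /turn /w1 /w2; set a := A i0 i0; set b := A i0 i1.
set c := A i1 i0; set d := A i1 i1 => dA tA.
have [c0|c0] := eqVneq c 0.
  by exists 0; rewrite sin_0 c0 R0E; ring.
pose D := (d - a) * (d - a) + 4 * (b * c).
have D0 : 0 <= D.
  suff -> : D = (a + d) * (a + d) - 4 * (a * d - b * c) by rewrite dA; lra.
  by rewrite /D; ring.
have sD : sqrt D * sqrt D = D by apply: sqrt_sqrt; exact/RleP.
pose x : R := (a - d + sqrt D) / (2 * c).
have xE : 2 * c * x = a - d + sqrt D by rewrite /x mulrC divfK// mulf_neq0// pnatr_eq0.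
have q0 : c * x * x + (d - a) * x - b = 0.
  have n4 : 4 * c != 0 by rewrite mulf_neq0// pnatr_eq0.
  apply: (mulfI n4); rewrite mulr0.
  transitivity ((2 * c * x) * (2 * c * x) + 2 * (d - a) * (2 * c * x) - 4 * (b * c)); first by ring.
  rewrite xE; transitivity (sqrt D * sqrt D - ((d - a) * (d - a) + 4 * (b * c))); first by ring.
  by rewrite sD subrr.
(* The angle whose cotangent is [x], so that e(u) is proportional to (x, 1). *)
exists (PI / 2 - atan x).
have -> : cos (PI / 2 - atan x) = sin (atan x) by rewrite -IZR2; exact: cos_shift.
have -> : sin (PI / 2 - atan x) = cos (atan x) by rewrite -IZR2; exact: sin_shift.
have -> : sin (atan x) = x * cos (atan x).
  by rewrite sin_atan cos_atan !RealsE; ring.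
set C := cos _; rewrite -(mulr0 (C * C)) -[in RHS]q0; ring.
Qed.

(* With J = [[p, q], [r, -p]] and J^2 = -1, this is exp (t J), conjugate to the rotation of angle t. *)
Definition rotm (p q r t : R) : Mat :=
  mk (cos t + p * sin t) (q * sin t) (r * sin t) (cos t - p * sin t).

Lemma rotmD (p q r s t : R) : p * p + q * r = -1 ->
  rotm p q r s *m rotm p q r t = rotm p q r (s + t).
Proof.
move=> e; apply: mx2P; rewrite /rotm !mx2E ?cosD ?sinD.
- transitivity (cos s * cos t + p * (cos s * sin t + sin s * cos t) + (p * p + q * r) * (sin s * sin t)); first by ring.
  by rewrite e; ring.
- by ring.
- by ring.
- transitivity (cos s * cos t - p * (cos s * sin t + sin s * cos t) + (p * p + q * r) * (sin s * sin t)); first by ring.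
  by rewrite e; ring.
Qed.

Lemma rotm_Zpi p q r t (k : Z) : psl_eq (rotm p q r (t + IZR k * PI)) (rotm p q r t).
Proof.
have [ss ct st] := cos_sin_addZ t k; rewrite {1}/rotm ct st.
have [->|->] : cos (IZR k * PI) = 1 \/ cos (IZR k * PI) = -1.
  have /eqP : (cos (IZR k * PI) - 1) * (cos (IZR k * PI) + 1) = 0.
    by transitivity (cos (IZR k * PI) * cos (IZR k * PI) - 1); [ring|rewrite ss subrr].
  by rewrite mulf_eq0 subr_eq0 addr_eq0 => /orP[/eqP|/eqP]; [left|right].
- by left; apply: mx2P; rewrite /rotm !mx2E; ring.
- by right; apply: mx2P; rewrite /rotm !mx2E; ring.
Qed.

(** The trace lies strictly between -2 and 2, so half of it is [cos t] with [sin t] nonzero. The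
    traceless matrix J = (A - cos t) / sin t has square -1 because A has determinant 1. *)
Lemma elliptic_rotm (A : Mat) : \det A = 1 -> ~ (exists u, turn A u = 0) ->
  exists p q r t, p * p + q * r = -1 /\ A = rotm p q r t.
Proof.
move=> dA nt.
have tA : (A i0 i0 + A i1 i1) * (A i0 i0 + A i1 i1) < 4.
  by rewrite ltNge; apply/negP => /(exists_turn_eq0 A dA).
pose c : R := (A i0 i0 + A i1 i1) / 2.
have c1 : -1 <= c <= 1 by rewrite /c; apply/andP; split; nra.
pose t := acos c.
have ct : cos t = c.
  by case/andP: c1 => /RleP h1 /RleP h2; apply: cos_acos.
have cs := cossq_sinsq t; rewrite ct in cs.
have s0 : sin t != 0.
  by apply/eqP => s0; move: cs; rewrite s0 /c; nra.
exists ((A i0 i0 - c) / sin t), (A i0 i1 / sin t), (A i1 i0 / sin t), t; split.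
  have s2 : sin t * sin t != 0 by rewrite mulf_neq0.
  apply: (mulIf s2).
  transitivity ((A i0 i0 - c) * (A i0 i0 - c) + A i0 i1 * A i1 i0); first by field.
  have -> : sin t * sin t = 1 - c * c by rewrite -cs; ring.
  by rewrite mulN1r -dA det2 /c; field.
apply: mx2P; rewrite /rotm !mx2E ?ct ?divfK//.
- by ring.
- by rewrite /c; field.
Qed.

Lemma mnorm2 A : mnorm A = `|A i0 i0| + `|A i0 i1| + (`|A i1 i0| + `|A i1 i1|).
Proof.
rewrite /mnorm !big_ord_recl !big_ord0 !addr0.
by congr (`|A _ _| + `|A _ _| + (`|A _ _| + `|A _ _|)); apply: val_inj.
Qed.

Lemma mnormN A : mnorm (- A) = mnorm A.
Proof. by rewrite !mnorm2 !oppmx2 !normrN. Qed.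

Lemma psl_dist_le A A' B B' : psl_eq A A' -> psl_eq B B' ->
  psl_dist A B <= mnorm (A' - B').
Proof.
move=> eA eB; have N : mnorm (- A' + B') = mnorm (A' - B') by rewrite -mnormN opprD opprK.
rewrite /psl_dist ge_min.
by case: eA => ->; case: eB => ->; rewrite ?opprK ?N lexx ?orbT.
Qed.

Lemma submx2 (A B : Mat) i j : (A - B) i j = A i j - B i j.
Proof. by rewrite !mxE. Qed.

Lemma rotm_near1 (p q r t : R) : mnorm (rotm p q r t - 1%:M) <=
  (2 + 2 * `|p| + `|q| + `|r|) * `|t|.
Proof.
have s1 := sin_norm_le t.
have c1 : `|cos t - 1| <= `|t|.
  have -> : cos t - 1 = - (2 * (sin (t / 2) * sin (t / 2))).
    have {1}-> : t = t / 2 + t / 2 by field.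
    by rewrite cosD; have := cossq_sinsq (t / 2); lra.
  have s2 := sin_norm_le (t / 2).
  have s3 : `|sin (t / 2)| <= 1.
    by rewrite ler_norml; apply/andP; split; apply/RleP; have [] := SIN_bound (t / 2).
  rewrite normrN !normrM (ger0_norm (x := 2))//.
  have : `|sin (t / 2)| * `|sin (t / 2)| <= `|t / 2| * 1 by apply: ler_pM.
  by rewrite normrM (ger0_norm (x := 2^-1))//; lra.
rewrite mnorm2 !submx2 /rotm !mx2E.
have -> : cos t + p * sin t - 1 = (cos t - 1) + p * sin t by ring.
have -> : cos t - p * sin t - 1 = (cos t - 1) - p * sin t by ring.
rewrite !subr0.
have := ler_normD (cos t - 1) (p * sin t).
have := ler_normB (cos t - 1) (p * sin t).
rewrite !normrM.
have pp (x : R) : `|x| * `|sin t| <= `|x| * `|t| by apply: ler_pM.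
by have := pp p; have := pp q; have := pp r; lra.
Qed.

Lemma box_modZ (N : nat) (z : R) : exists j : 'I_N.+1, exists k : Z,
  (j : nat)%:R * PI <= (z + IZR k * PI) * N.+1%:R < (j : nat).+1%:R * PI.
Proof.
have pi0 := pi_gt0; have [k /andP[k1 k2]] := below_modZ z PI.
have N0 : 0 < N.+1%:R :> R by rewrite ltr0n.
pose y : R := (z + IZR k * PI) * N.+1%:R / PI.
have yE : y * PI = (z + IZR k * PI) * N.+1%:R by rewrite /y divfK// lt0r_neq0.
have y0 : 0 <= y by rewrite -(pmulr_lge0 _ pi0) yE pmulr_lge0//; lra.
have yN : y < N.+1%:R.
  by rewrite -(ltr_pM2r pi0) yE mulrC ltr_pM2l.
have tN : leq (Num.Def.trunc y).+1 N.+1 by rewrite truncn_lt_nat.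
have /andP[t1 t2] := truncn_itv y0.
by exists (Ordinal tN), k; rewrite -yE /= ler_pM2r// t1 ltr_pM2r.
Qed.

(** Pigeonhole on the torus of side [PI]: two multiples of (x, y) fall in the same small box, and
    their difference is the one sought. *)
Lemma simultaneous_dirichlet (x y e : R) : 0 < e -> exists n : nat,
  exists k l : Z, `|n.+1%:R * x - IZR k * PI| < e /\ `|n.+1%:R * y - IZR l * PI| < e.
Proof.
move=> e0; have pi0 := pi_gt0.
(* Makes the side [PI / (N + 1)] of a box smaller than [e]. *)
pose N := Num.Def.archi_bound (PI / e).
have NE : PI < N.+1%:R * e.
  rewrite -ltr_pdivrMr//; have /archi_boundP : 0 <= PI / e by rewrite divr_ge0// ltW.
  by move=> h; apply: lt_trans h _; rewrite ltr_nat.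
have N0 : 0 < N.+1%:R :> R by rewrite ltr0n.
(* One more multiple than there are boxes. *)
pose T := 'I_(muln N.+1 N.+1).+1.
have [jx hx] := fin_all_exists (fun i : T => box_modZ N ((i : nat)%:R * x)).
have [jy hy] := fin_all_exists (fun i : T => box_modZ N ((i : nat)%:R * y)).
pose F (i : T) := (jx i, jy i).
have [i1 [i2 ne [e1 e2]]] : exists i1, exists2 i2, i1 != i2 & F i1 = F i2.
  apply/injectivePn/negP => /injectiveP/leq_card.
  by rewrite card_prod !card_ord ltnn.
wlog lt : i1 i2 ne e1 e2 / leq i1.+1 i2.
  move=> H; have [lt|lt|eq] := ltngtP i1 i2.
  - exact: (H i1 i2).
  - by apply: (H i2 i1) => //; rewrite eq_sym.
  - by move: ne; rewrite (ord_inj eq) eqxx.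
have diff (J : T -> 'I_N.+1) (z : R) : J i1 = J i2 ->
    (forall i, exists k : Z, (J i : nat)%:R * PI <= ((i : nat)%:R * z + IZR k * PI) * N.+1%:R < (J i : nat).+1%:R * PI) ->
    exists k : Z, `|(subn i2 i1)%:R * z - IZR k * PI| < e.
  move=> eJ h; have [k1 /andP[a1 b1]] := h i1; have [k2 /andP[a2 b2]] := h i2.
  exists (k1 - k2)%Z; rewrite natrB 1?ltnW// IZRD IZRN.
  rewrite -eJ in a2 b2; rewrite -natr1 in b1 b2.
  rewrite -(ltr_pM2r N0) -[X in _ * X](gtr0_norm N0) -normrM [e * _]mulrC.
  by apply: lt_trans NE; rewrite ltr_norml; apply/andP; split; lra.
have [k hk] := diff jx x e1 hx; have [l hl] := diff jy y e2 hy.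
exists (subn i2 i1).-1, k, l; rewrite prednK ?subn_gt0//.
Qed.

Lemma psl_rep0 (Gam : zmodType) (r : Gam -> Mat) : is_psl_rep r -> psl_eq (r 0) 1%:M.
Proof.
move=> [dr /(_ 0 0)]; rewrite addr0 => h.
have [h1 _] := invmxK2 _ (dr 0).
have := psl_mul _ _ _ _ h (psl_refl (invmx (r 0))).
by rewrite -mulmxA h1 mulmx1 => /psl_sym.
Qed.

Lemma psl_rep_rotm (Gam : zmodType) (r : Gam -> Mat) g a b c t : is_psl_rep r ->
  a * a + b * c = -1 -> r g = rotm a b c t ->
  forall n, psl_eq (r (g *+ n)) (rotm a b c (n%:R * t)).
Proof.
move=> hr e rg; elim=> [|n ih].
  rewrite mulr0n mul0r; apply: psl_trans (psl_rep0 _ _ hr) _.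
  have c0 : cos 0 = 1 := cos_0; have s0 : sin 0 = 0 := sin_0.
  by left; apply: mx2P; rewrite /rotm !mx2E ?c0 ?s0; ring.
rewrite mulrS; apply: psl_trans (hr.2 _ _) _.
rewrite -natr1 mulrDl mul1r addrC -rotmD// -rg.
by apply: psl_mul => //; exact: psl_refl.
Qed.

Lemma turn1 A u : psl_eq A 1%:M -> turn A u = 0.
Proof.
move=> /psl_sym h; apply: turn_psl h _; rewrite /turn /w1 /w2 !mx2E; ring.
Qed.

(** Some positive multiple of [g] has both rotation angles close to multiples of [PI], so
    discreteness at 0 makes its image trivial. Faithfulness and torsion-freeness give [g = 0], whose
    image fixes every line. *)
Lemma elliptic_pair_absurd (Gam : zmodType) (rL rR : Gam -> Mat) g :
  torsion_free Gam -> is_psl_rep rL -> is_psl_rep rR -> faithful_rep rL rR ->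
  discrete_image rL rR -> ~ (exists u, turn (rL g) u = 0) ->
  ~ (exists u, turn (rR g) u = 0) -> False.
Proof.
move=> tf hL hR fa di nL nR.
have [a [b [c [t [eL rLg]]]]] := elliptic_rotm _ (hL.1 g) nL.
have [a' [b' [c' [t' [eR rRg]]]]] := elliptic_rotm _ (hR.1 g) nR.
have [eps [e0 he]] := di 0.
(* Dominates the constants of [rotm_near1] for both factors. *)
pose C : R := 2 + 2 * `|a| + `|b| + `|c| + (2 + 2 * `|a'| + `|b'| + `|c'|).
have C0 : 0 < C.
  rewrite /C; have := normr_ge0 a; have := normr_ge0 b; have := normr_ge0 c.
  by have := normr_ge0 a'; have := normr_ge0 b'; have := normr_ge0 c'; lra.
have [|n [k [l [hk hl]]]] := simultaneous_dirichlet t t' (eps / C).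
  by rewrite divr_gt0.
have close (r : Gam -> Mat) p q s x (m : Z) : is_psl_rep r -> p * p + q * s = -1 ->
    r g = rotm p q s x -> 2 + 2 * `|p| + `|q| + `|s| <= C ->
    `|n.+1%:R * x - IZR m * PI| < eps / C -> psl_dist (r (g *+ n.+1)) (r 0) < eps.
  move=> hr e rg leC lt.
  have eqr : psl_eq (r (g *+ n.+1)) (rotm p q s (n.+1%:R * x - IZR m * PI)).
    apply: psl_trans (psl_rep_rotm _ r g _ _ _ _ hr e rg n.+1) _.
    apply: psl_sym; have := rotm_Zpi p q s (n.+1%:R * x) (- m).
    by rewrite IZRN mulNr.
  apply: le_lt_trans (psl_dist_le _ _ _ _ eqr (psl_rep0 _ _ hr)) _.
  apply: le_lt_trans (rotm_near1 _ _ _ _) _.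
  apply: (@le_lt_trans _ _ (C * `|n.+1%:R * x - IZR m * PI|)).
    by apply: ler_wpM2r.
  by move: lt; rewrite ltr_pdivlMr// mulrC.
have nn (x y z : R) : 0 <= 2 + 2 * `|x| + `|y| + `|z|.
  by have := normr_ge0 x; have := normr_ge0 y; have := normr_ge0 z; lra.
have [||h1 h2] := he (g *+ n.+1).
- by apply: (close rL a b c t k) => //; have := nn a' b' c'; rewrite /C; lra.
- by apply: (close rR a' b' c' t' l) => //; have := nn a b c; rewrite /C; lra.
have /tf g0 : g *+ n.+1 = 0.
  by apply: fa; [apply: psl_trans h1 _|apply: psl_trans h2 _]; exact: psl_rep0.
by apply: nL; exists 0; apply: turn1; rewrite g0; exact: psl_rep0.
Qed.

(** * Normal forms of abelian groups without elliptic elements *)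

Lemma invmx2 (P : Mat) : \det P = 1 ->
  invmx P = mk (P i1 i1) (- P i0 i1) (- P i1 i0) (P i0 i0).
Proof.
move=> dP; set Q := mk _ _ _ _.
have PQ : P *m Q = 1%:M.
  move: dP; rewrite det2 => dP.
  by apply: mx2P; rewrite /Q !mx2E -?dP; ring.
by rewrite -[LHS]mulmx1 -PQ mulmxA (invmxK2 P dP).2 mul1mx.
Qed.

Lemma mk_eta (B : Mat) : B = mk (B i0 i0) (B i0 i1) (B i1 i0) (B i1 i1).
Proof. by apply: mx2P; rewrite !mkE. Qed.

Lemma conjm_conjm P Q A : \det P = 1 -> \det Q = 1 ->
  conjm P (conjm Q A) = conjm (P *m Q) A.
Proof.
move=> dP dQ; have dPQ : \det (P *m Q) = 1 by rewrite det_mulmx dP dQ mulr1.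
by rewrite /conjm !invmx2//; apply: mx2P; rewrite !mx2E; ring.
Qed.

Lemma conjm_mul P A B : \det P = 1 -> conjm P (A *m B) = conjm P A *m conjm P B.
Proof.
move=> dP; have [_ h] := invmxK2 P dP.
by rewrite /conjm -!mulmxA [invmx P *m (P *m _)]mulmxA h mul1mx.
Qed.

Lemma conjm_psl P A B : psl_eq A B -> psl_eq (conjm P A) (conjm P B).
Proof.
move=> h; apply: psl_mul; last exact: psl_refl.
by apply: psl_mul => //; exact: psl_refl.
Qed.

Lemma conjm1_psl P A : \det P = 1 -> psl_eq (conjm P A) 1%:M -> psl_eq A 1%:M.
Proof.
move=> dP h; have [h1 h2] := invmxK2 P dP.
have -> : A = invmx P *m conjm P A *m P.
  by rewrite /conjm !mulmxA h2 mul1mx -mulmxA h2 mulmx1.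
have := psl_mul _ _ _ _ (psl_mul _ _ _ _ (psl_refl (invmx P)) h) (psl_refl P).
by rewrite mulmx1 h2.
Qed.

(** The rotation taking the line [u] to the first axis turns the lower left entry into
    [turn A u]. *)
Lemma triangular_conj A u : turn A u = 0 ->
  exists2 P, \det P = 1 & conjm P A i1 i0 = 0.
Proof.
move=> tu; exists (mk (cos u) (sin u) (- sin u) (cos u)).
  by rewrite det2 !mx2E -(cossq_sinsq u); ring.
rewrite /conjm invmx2; last by rewrite det2 !mx2E -(cossq_sinsq u); ring.
by rewrite !mx2E -[RHS]tu /turn /w1 /w2; ring.
Qed.

Lemma diag_psl_expDelta (B : Mat) : \det B = 1 -> B i0 i1 = 0 -> B i1 i0 = 0 ->
  exists l, psl_eq B (expDelta l).
Proof.
rewrite det2 => dB b01 b10; rewrite b01 mul0r subr0 in dB.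
have expK (x y : R) : 0 < x -> x * y = 1 -> exp (ln x) = x /\ exp (- ln x) = y.
  move=> x0 xy; have e : exp (ln x) = x by apply: exp_ln; exact/RltP.
  split=> //; rewrite -RoppE exp_Ropp e RinvE.
  by apply: (mulfI (lt0r_neq0 x0)); rewrite xy mulfV// lt0r_neq0.
have [x0|x0|x0] := ltgtP (B i0 i0) 0; last by move: dB; rewrite x0 mul0r => /eqP; rewrite eq_sym oner_eq0.
- have [||e1 e2] := expK (- B i0 i0) (- B i1 i1); [by rewrite oppr_gt0|by rewrite mulrNN|].
  exists (ln (- B i0 i0)); right.
  by apply: mx2P; rewrite !mx2E ?e1 ?e2 ?b01 ?b10 ?opprK ?oppr0.
- have [||e1 e2] := expK (B i0 i0) (B i1 i1) => //.
  exists (ln (B i0 i0)); left.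
  by apply: mx2P; rewrite !mx2E ?e1 ?e2 ?b01 ?b10.
Qed.

Lemma unip_psl_expH (B : Mat) : \det B = 1 -> B i1 i0 = 0 -> B i1 i1 = B i0 i0 ->
  exists e, psl_eq B (expH e).
Proof.
rewrite det2 => dB b10 b11; rewrite b10 b11 mulr0 subr0 in dB.
have : B i0 i0 = 1 \/ B i0 i0 = -1.
  have /eqP : (B i0 i0 - 1) * (B i0 i0 + 1) = 0.
    by transitivity (B i0 i0 * B i0 i0 - 1); [ring|rewrite dB subrr].
  by rewrite mulf_eq0 subr_eq0 addr_eq0 => /orP[/eqP|/eqP]; [left|right].
case=> b00.
- by exists (B i0 i1); left; apply: mx2P; rewrite !mx2E ?b11 ?b00 ?b10.
- exists (- B i0 i1); right.
  by apply: mx2P; rewrite !mx2E ?b11 ?b00 ?b10 ?opprK ?oppr0.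
Qed.

Lemma commute_diag (a d : R) (B : Mat) : a * d = 1 -> a != d -> \det B = 1 ->
  psl_eq (mk a 0 0 d *m B) (B *m mk a 0 0 d) -> B i0 i1 = 0 /\ B i1 i0 = 0.
Proof.
move=> ad nad; rewrite det2 => dB [] e.
- have e01 : (mk a 0 0 d *m B) i0 i1 = (B *m mk a 0 0 d) i0 i1 by rewrite e.
  have e10 : (mk a 0 0 d *m B) i1 i0 = (B *m mk a 0 0 d) i1 i0 by rewrite e.
  have ad0 : a - d != 0 by rewrite subr_eq0.
  split; apply: (mulfI ad0); rewrite mulr0.
    by move: e01; rewrite !mx2E; lra.
  by move: e10; rewrite !mx2E; lra.
(* Commuting only up to sign: since [a * d = 1] excludes [a + d = 0], anticommutation kills the
   first row of [B]. *)
- have a0 : a != 0 by apply/eqP => a0; move: ad; rewrite a0; lra.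
  have d0 : a + d != 0 by apply/eqP => h; nra.
  have e00 : (mk a 0 0 d *m B) i0 i0 = (- (B *m mk a 0 0 d)) i0 i0 by rewrite e.
  have e01 : (mk a 0 0 d *m B) i0 i1 = (- (B *m mk a 0 0 d)) i0 i1 by rewrite e.
  have b00 : B i0 i0 = 0 by apply: (mulfI a0); move: e00; rewrite !mx2E; lra.
  have b01 : B i0 i1 = 0 by apply: (mulfI d0); move: e01; rewrite !mx2E; lra.
  by move: dB; rewrite b00 b01; lra.
Qed.

Lemma commute_unip (a e : R) (B : Mat) : a != 0 -> e != 0 -> \det B = 1 ->
  psl_eq (mk a e 0 a *m B) (B *m mk a e 0 a) -> B i1 i0 = 0 /\ B i1 i1 = B i0 i0.
Proof.
move=> a0 e0; rewrite det2 => dB [] h.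
- have h00 : (mk a e 0 a *m B) i0 i0 = (B *m mk a e 0 a) i0 i0 by rewrite h.
  have h01 : (mk a e 0 a *m B) i0 i1 = (B *m mk a e 0 a) i0 i1 by rewrite h.
  split; apply: (mulfI e0).
    by move: h00; rewrite !mx2E; lra.
  by move: h01; rewrite !mx2E; lra.
(* Anticommutation would kill the first column of [B]. *)
- have h10 : (mk a e 0 a *m B) i1 i0 = (- (B *m mk a e 0 a)) i1 i0 by rewrite h.
  have h00 : (mk a e 0 a *m B) i0 i0 = (- (B *m mk a e 0 a)) i0 i0 by rewrite h.
  have b10 : B i1 i0 = 0 by apply: (mulfI a0); move: h10; rewrite !mx2E; lra.
  have b00 : B i0 i0 = 0 by apply: (mulfI a0); move: h00; rewrite !mx2E b10; lra.
  by move: dB; rewrite b00 b10; lra.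
Qed.

(** It suffices to normalize one nontrivial element [g0]: its centralizer in PSL(2,R) is diagonal or
    unipotent, according as its eigenvalues differ or coincide, and contains the whole image. *)
Lemma nonelliptic_normal_form (Gam : zmodType) (r : Gam -> Mat) : is_psl_rep r ->
  (forall g, exists u, turn (r g) u = 0) ->
  exists2 P, \det P = 1 &
    (forall g, exists l, psl_eq (conjm P (r g)) (expDelta l)) \/
    (forall g, exists e, psl_eq (conjm P (r g)) (expH e)).
Proof.
move=> [dr rD] ne.
have comm P g h : \det P = 1 ->
    psl_eq (conjm P (r g) *m conjm P (r h)) (conjm P (r h) *m conjm P (r g)).
  move=> dP; rewrite -!conjm_mul//; apply: conjm_psl.
  apply: psl_trans (psl_sym _ _ (rD g h)) _; rewrite addrC; exact: rD.
have [triv|/not_all_ex_not[g0 ng0]] := classic (forall g, psl_eq (r g) 1%:M).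
  exists 1%:M; first exact: det1.
  left=> g; exists 0; rewrite /conjm mul1mx invmx1 mulmx1.
  apply: psl_trans (triv g) _; left.
  have e0 : exp 0 = 1 := exp_0.
  by apply: mx2P; rewrite !mx2E ?RoppE ?oppr0 ?e0.
have [u tu] := ne g0; have [P dP b10] := triangular_conj _ _ tu.
have dB : \det (conjm P (r g0)) = 1 by rewrite det_conjm.
have ad := dB; rewrite det2 b10 mulr0 subr0 in ad.
set a : R := conjm P (r g0) i0 i0 in ad; set e : R := conjm P (r g0) i0 i1.
set d : R := conjm P (r g0) i1 i1 in ad.
have BE : conjm P (r g0) = mk a e 0 d by rewrite [LHS]mk_eta b10.
have [aed|aed] := eqVneq a d; last first.
  (* The shear that clears the upper right entry [e]. *)
  pose T := mk 1 (e / (a - d)) 0 1.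
  have dT : \det T = 1 by rewrite det2 !mx2E; ring.
  have ad0 : a - d != 0 by rewrite subr_eq0.
  have dTP : \det (T *m P) = 1 by rewrite det_mulmx dT dP mulr1.
  exists (T *m P) => //; left=> g.
  have DE : conjm (T *m P) (r g0) = mk a 0 0 d.
    rewrite -conjm_conjm// BE /conjm invmx2//.
    by apply: mx2P; rewrite /T !mx2E; field.
  have dg : \det (conjm (T *m P) (r g)) = 1 by rewrite det_conjm.
  have := comm _ g0 g dTP; rewrite DE => /(commute_diag _ _ _ ad aed dg)[].
  exact: diag_psl_expDelta.
exists P => //; right=> g.
have dg : \det (conjm P (r g)) = 1 by rewrite det_conjm.
have a0 : a != 0 by apply/eqP => a0; move: ad; rewrite a0; lra.
have e0 : e != 0.
  apply/eqP => e0; apply: ng0; apply: (conjm1_psl P) => //.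
  rewrite BE e0 -aed.
  have /eqP : (a - 1) * (a + 1) = 0.
    by transitivity (a * d - 1); [rewrite -aed; ring|rewrite ad subrr].
  rewrite mulf_eq0 subr_eq0 addr_eq0 => /orP[/eqP->|/eqP->]; [left|right].
    by apply: mx2P; rewrite !mx2E.
  by apply: mx2P; rewrite !mx2E ?oppr0.
have := comm _ g0 g dP; rewrite BE -aed => /(commute_unip _ _ _ a0 e0 dg)[].
exact: unip_psl_expH.
Qed.

(** Conjugation by [P] preserves determinants of pairs of vectors, and det ((x, y), exp(aH) (x, y))
    = - a y^2. The nonnegative trace of [posrep A] rules out the sign -1. *)
Lemma turn_parabolic P A a u : \det P = 1 -> psl_eq (conjm P A) (expH a) ->
  turn (posrep A) u = - a * (w2 P u * w2 P u).
Proof.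
move=> dP hA.
have := psl_trans _ _ _ (conjm_psl P _ _ (posrep_psl A)) hA.
have := posrep_tr A; set B := posrep A => tB.
have trB : B i0 i0 + B i1 i1 = conjm P B i0 i0 + conjm P B i1 i1.
  rewrite /conjm invmx2// !mx2E.
  transitivity ((B i0 i0 + B i1 i1) * (P i0 i0 * P i1 i1 - P i0 i1 * P i1 i0)); last by ring.
  by rewrite -det2 dP mulr1.
case=> e; last by move: tB; rewrite trB e !mx2E R1E; lra.
have [h1 h2] := invmxK2 P dP.
have -> : B = invmx P *m expH a *m P.
  by rewrite -e /conjm !mulmxA h2 mul1mx -mulmxA h2 mulmx1.
rewrite invmx2// /turn /w1 /w2 !mx2E R1E R0E.
by move: dP; rewrite det2 => dP; ring.
Qed.

(** The equation says that [P] maps the line to the first axis, which singles out one line. *)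
Lemma w2_eq0_modZ P u v : \det P = 1 -> w2 P u = 0 -> w2 P v = 0 ->
  exists k : Z, v = u + IZR k * PI.
Proof.
rewrite det2 => dP u0 v0.
suff /sin_eq0_Z[k hk] : sin (v - u) = 0 by exists k; rewrite -hk; ring.
rewrite sinD cos_neg sin_neg RoppE -[LHS]mul1r -dP.
transitivity (w1 P u * w2 P v - w1 P v * w2 P u); last by rewrite u0 v0; ring.
by rewrite /w1 /w2; ring.
Qed.

Lemma parabolic_dynamics P A a : \det P = 1 -> \det A = 1 ->
  psl_eq (conjm P A) (expH a) -> forall u : R,
  [/\ 0 < a -> canlift A u <= u, a < 0 -> u <= canlift A u &
      a != 0 -> canlift A u = u -> w2 P u = 0].
Proof.
move=> dP dA hA u; have t := turn_parabolic P A a u dP hA.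
have dB := posrep_det A dA; have tB := posrep_tr A.
rewrite /canlift /angle_lift.
have [w0|w0] := eqVneq (w2 P u) 0.
  by split=> // _; rewrite angle_eq0 ?addr0// t w0 mulr0 mulr0.
have w2p : 0 < w2 P u * w2 P u by rewrite lt0r mulf_neq0//= -expr2 sqr_ge0.
have neg : 0 < a -> angle (posrep A) u < 0.
  by move=> a0; apply: angle_lt0 => //; rewrite t mulNr oppr_lt0 mulr_gt0.
have pos : a < 0 -> 0 < angle (posrep A) u.
  by move=> a0; apply: angle_gt0 => //; rewrite t mulr_gt0// oppr_gt0.
split=> [/neg|/pos|]; [lra|lra|].
by move=> a0 e; case: (ltgtP a 0) a0 => // [/pos|/neg]; lra.
Qed.

(** * Pairs of unipotent groups *)

Lemma expHD (x y : R) : expH x *m expH y = expH (x + y).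
Proof. by apply: mx2P; rewrite !mx2E ?R1E ?R0E; ring. Qed.

Lemma expH_inj (x y : R) : psl_eq (expH x) (expH y) -> x = y.
Proof.
case=> e; first by have := congr1 (fun M : Mat => M i0 i1) e; rewrite !mkE.
have := congr1 (fun M : Mat => M i0 i0) e; rewrite !mx2E R1E; lra.
Qed.

Lemma unipotent_coord (Gam : zmodType) (r : Gam -> Mat) P : is_psl_rep r ->
  \det P = 1 -> (forall g, exists e, psl_eq (conjm P (r g)) (expH e)) ->
  exists a : Gam -> R, (forall g, psl_eq (conjm P (r g)) (expH (a g))) /\
    forall g h, a (g + h) = a g + a h.
Proof.
move=> [dr rD] dP h.
(* The quotient does not see the sign of the representative, so it recovers the parameter of
   [expH]. *)
pose a g : R := conjm P (r g) i0 i1 / conjm P (r g) i0 i0.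
have ha g : psl_eq (conjm P (r g)) (expH (a g)).
  have [e he] := h g; suff -> : a g = e by [].
  by rewrite /a; case: he => ->; rewrite !mx2E ?R1E ?divr1// invrN invr1 mulrNN mulr1.
exists a; split=> // g k; apply: expH_inj.
apply: psl_trans (psl_sym _ _ (ha _)) _.
apply: psl_trans (conjm_psl P _ _ (rD g k)) _.
by rewrite conjm_mul// -expHD; apply: psl_mul.
Qed.

Lemma additiveMz (Gam : zmodType) (a : Gam -> R) : (forall g h, a (g + h) = a g + a h) ->
  forall g (z : int), a (g *~ z) = z%:~R * a g.
Proof.
move=> aD g; have a0 : a 0 = 0 by have := aD 0 0; rewrite addr0; lra.
have an (n : nat) : a (g *+ n) = n%:R * a g.
  by elim: n => [|n ih]; [rewrite mulr0n a0 mul0r|rewrite mulrS aD ih -nat1r mulrDl mul1r].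
case=> n; first exact: an.
have := aD (g *~ Negz n) (g *+ n.+1).
rewrite NegzE mulrNz addNr a0 an mulrNz mulNr => e.
by move: e; rewrite -pmulrn; lra.
Qed.

(* Otherwise (a, b) maps integer combinations of g and h close to every direction of the plane. *)
Lemma additive_collinear (Gam : zmodType) (a b : Gam -> R) :
  (forall g h, a (g + h) = a g + a h) -> (forall g h, b (g + h) = b g + b h) ->
  (forall g, ~ (0 < a g /\ b g < 0)) -> forall g h, a g * b h = a h * b g.
Proof.
move=> aD bD nab g h; apply/eqP; rewrite -subr_eq0; apply/negPn/negP => D0.
set D := _ - _ in D0.
(* Exceeds the error made by rounding the real coefficients below to integers. *)
pose K : R := `|a g| + `|a h| + `|b g| + `|b h| + 1.
have nn := (normr_ge0 (a g), normr_ge0 (a h), normr_ge0 (b g), normr_ge0 (b h)).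
(* Cramer's rule for x (a g, b g) + y (a h, b h) = (K, -K). *)
pose x : R := K * (b h + a h) / D; pose y : R := K * (- a g - b g) / D.
have xD : x * D = K * (b h + a h) by rewrite /x divfK.
have yD : y * D = K * (- a g - b g) by rewrite /y divfK.
have ex : x * a g + y * a h = K.
  apply: (mulIf D0); transitivity (x * D * a g + y * D * a h); first by ring.
  by rewrite xD yD /D; ring.
have ey : x * b g + y * b h = - K.
  apply: (mulIf D0); transitivity (x * D * b g + y * D * b h); first by ring.
  by rewrite xD yD /D; ring.
pose n := Num.Def.floor x; pose m := Num.Def.floor y.
have err (c d : R) : `|n%:~R * c + m%:~R * d - (x * c + y * d)| <= `|c| + `|d|.
  have fl (z : R) : `|(Num.Def.floor z)%:~R - z| <= 1.
    have /andP[f1 f2] := floor_itv z; rewrite intrD in f2.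
    by rewrite ler_norml; apply/andP; split; lra.
  have -> : n%:~R * c + m%:~R * d - (x * c + y * d) = (n%:~R - x) * c + (m%:~R - y) * d by ring.
  apply: le_trans (ler_normD _ _) _; rewrite !normrM.
  by apply: lerD; rewrite -[leRHS]mul1r ler_wpM2r//; exact: fl.
apply: (nab (g *~ n + h *~ m)); rewrite aD bD !additiveMz//.
have := err (a g) (a h); have := err (b g) (b h); rewrite ex ey !ler_norml.
case: nn => [[[]]] p1 p2 p3 p4 /andP[e1 e2] /andP[e3 e4].
by rewrite /K in e1 e2 e3 e4; split; lra.
Qed.

Lemma saturated_swap L : saturated L -> saturated (fun x => L (x.2, x.1)).
Proof. by move=> sL x; exact: (sL (x.2, x.1)). Qed.

Lemma achronal_swap L : achronal L -> achronal (fun x => L (x.2, x.1)).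
Proof. by move=> aL x y Lx Ly [h1 h2]; exact: (aL _ _ Ly Lx (conj h2 h1)). Qed.

(** A positive parameter moves points down and a negative one moves them up, so [g] and [- g]
    satisfy the hypotheses of [opposite_dynamics]. *)
Lemma parabolic_opposite (Gam : zmodType) (rL rR : Gam -> Mat) P Q
    (a b : Gam -> R) L : is_psl_rep rL -> is_psl_rep rR -> \det P = 1 -> \det Q = 1 ->
  (forall g, psl_eq (conjm P (rL g)) (expH (a g))) ->
  (forall g, psl_eq (conjm Q (rR g)) (expH (b g))) ->
  (forall g h, a (g + h) = a g + a h) -> (forall g h, b (g + h) = b g + b h) ->
  (forall g, exists u, turn (rL g) u = 0) -> (forall g, exists u, turn (rR g) u = 0) ->
  saturated L -> closed2 L -> achronal L -> generic L -> two_points L ->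
  (forall g y, L y -> L (canlift (rL g) y.1, canlift (rR g) y.2)) ->
  forall g, ~ (0 < a g /\ b g < 0).
Proof.
move=> hL hR dP dQ ha hb aD bD neL neR sL cL aL gL tp inv g [ag bg].
have opp (c : Gam -> R) : (forall g h, c (g + h) = c g + c h) -> c (- g) = - c g.
  move=> cD; have := cD g (- g); rewrite subrr.
  by have := cD 0 0; rewrite addr0; lra.
have nag : a (- g) < 0 by rewrite opp// oppr_lt0.
have nbg : 0 < b (- g) by rewrite opp// oppr_gt0.
have lLg := proj_lift_canlift _ (hL.1 g); have lRg := proj_lift_canlift _ (hR.1 g).
have lLn := proj_lift_canlift _ (hL.1 (- g)); have lRn := proj_lift_canlift _ (hR.1 (- g)).
have dLg := parabolic_dynamics P _ _ dP (hL.1 g) (ha g).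
have dLn := parabolic_dynamics P _ _ dP (hL.1 (- g)) (ha (- g)).
have dRg := parabolic_dynamics Q _ _ dQ (hR.1 g) (hb g).
have dRn := parabolic_dynamics Q _ _ dQ (hR.1 (- g)) (hb (- g)).
have [u0 tu0] := neL g; have [v0 tv0] := neR g.
have [u1 tu1] := neL (- g); have [v1 tv1] := neR (- g).
apply: (opposite_dynamics L (canlift (rL g)) (canlift (rR g)) (canlift (rL (- g)))
  (canlift (rR (- g))) (fun u => w2 P u = 0) (fun v => w2 Q v = 0) u0 v0 u1 v1) tp => //.
- exact: lLg.1.
- exact: lRg.1.
- exact: lLn.1.
- exact: lRn.1.
- exact: proj_lift_mono (hL.1 g) lLg.
- exact: proj_lift_mono (hR.1 g) lRg.
- exact: proj_lift_mono (hL.1 (- g)) lLn.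
- exact: proj_lift_mono (hR.1 (- g)) lRn.
- by move=> x k; apply: (proj_lift_addZ (rL g) _ _ _ (hL.1 g)).
- by move=> x k; apply: (proj_lift_addZ (rR g) _ _ _ (hR.1 g)).
- by move=> x k; apply: (proj_lift_addZ (rL (- g)) _ _ _ (hL.1 (- g))).
- by move=> x k; apply: (proj_lift_addZ (rR (- g)) _ _ _ (hR.1 (- g))).
- exact: canlift_fix.
- exact: canlift_fix.
- exact: canlift_fix.
- exact: canlift_fix.
- by move=> x; have [/(_ ag)] := dLg x.
- by move=> x; have [_ /(_ bg)] := dRg x.
- by move=> x; have [_ /(_ nag)] := dLn x.
- by move=> x; have [/(_ nbg)] := dRn x.
- by move=> x; have [_ _] := dLg x; apply; exact: lt0r_neq0.
- by move=> x; have [_ _] := dLn x; apply; exact: ltr0_neq0.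
- by move=> x; have [_ _] := dRg x; apply; exact: ltr0_neq0.
- by move=> x; have [_ _] := dRn x; apply; exact: lt0r_neq0.
- by move=> x y; exact: w2_eq0_modZ.
- by move=> x y; exact: w2_eq0_modZ.
- exact: inv.
- exact: inv.
Qed.

(** Conjugation in SL(2,R) rescales the unipotent parameter by a square, so only a positive ratio of
    parameters can be normalized to 1. *)
Lemma conjm_diag_expH (s e : R) : s != 0 ->
  \det (mk s 0 0 s^-1) = 1 /\ conjm (mk s 0 0 s^-1) (expH e) = expH (s * s * e).
Proof.
move=> s0; have d : \det (mk s 0 0 s^-1) = 1.
  by rewrite det2 !mx2E mulfV// mulr0 subr0.
split=> //; rewrite /conjm invmx2//; apply: mx2P; rewrite !mx2E ?R1E ?R0E; field => //.
Qed.

(** * From an admissible representation to its model *)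

Lemma model_of_admissible (Gam : zmodType) (rL rR : Gam -> Mat) :
  torsion_free Gam -> is_psl_rep rL -> is_psl_rep rR -> admissible rL rR ->
  in_model rL rR inAhyp \/ in_model rL rR inAext \/ in_model rL rR inApar.
Proof.
move=> tf hL hR [fa [di [FL [FR [[lF _] [L [sL [cL [aL [gL [tp inv]]]]]]]]]]].
have [x0 [_ [Lx0 _]]] := tp.
have norm g v : turn (rR g) v = 0 -> (exists u, turn (rL g) u = 0) /\
    forall y, L y -> L (canlift (rL g) y.1, canlift (rR g) y.2).
  by apply: (canlift_normalize _ _ (FL g) (FR g) L x0) => //;
    [exact: hL.1|exact: hR.1|have [] := lF g|have [] := lF g|exact: inv].
have normS g u : turn (rL g) u = 0 -> exists v, turn (rR g) v = 0.
  move=> tu; have [] // := canlift_normalize (rR g) (rL g) (FR g) (FL g)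
    (fun x => L (x.2, x.1)) (x0.2, x0.1) u (hR.1 g) (hL.1 g) (proj2 (lF g)) (proj1 (lF g))
    (saturated_swap L sL) (achronal_swap L aL) _ _ tu.
  - by rewrite -surjective_pairing.
  - by move=> y; exact: (inv g (y.2, y.1)).
(* If [rR g] fixed no line, neither would [rL g], and both components would be elliptic. *)
have neR g : exists v, turn (rR g) v = 0.
  apply: NNPP => nR; apply: (elliptic_pair_absurd _ rL rR g) => //.
  by move=> [u /normS].
have neL g : exists u, turn (rL g) u = 0 by have [v /norm[]] := neR g.
have inv' g y : L y -> L (canlift (rL g) y.1, canlift (rR g) y.2).
  by have [v /norm[_]] := neR g; apply.
have [P dP [DL|HL]] := nonelliptic_normal_form _ rL hL neL;
  have [Q dQ [DR|HR]] := nonelliptic_normal_form _ rR hR neR.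
- left; exists P, Q; do 2!split=> //; left=> g.
  by have [l hl] := DL g; have [m hm] := DR g; exists l, m.
- right; left; exists P, Q; do 2!split=> //; left=> g.
  by have [l hl] := DL g; have [m hm] := HR g; exists l, m.
- right; left; exists P, Q; do 2!split=> //; right=> g.
  by have [l hl] := HL g; have [m hm] := DR g; exists m, l.
have [a [ha aD]] := unipotent_coord _ _ _ hL dP HL.
have [b [hb bD]] := unipotent_coord _ _ _ hR dQ HR.
have expH0 : expH 0 = expDelta 0.
  have e0 : exp 0 = 1 := exp_0.
  by rewrite /expH /expDelta RoppE oppr0 e0.
(* A trivial unipotent factor also counts as diagonal with parameter 0, which puts the pair in the
   second model. *)
have [a0|/not_all_ex_not[g1 a1]] := classic (forall g, a g = 0).
  right; left; exists P, Q; do 2!split=> //; left=> g; exists 0, (b g).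
  by rewrite -expH0 -(a0 g).
have [b0|/not_all_ex_not[g2 b2]] := classic (forall g, b g = 0).
  right; left; exists P, Q; do 2!split=> //; right=> g; exists 0, (a g).
  by rewrite -expH0 -(b0 g).
have nab := parabolic_opposite _ _ _ P Q a b L hL hR dP dQ ha hb aD bD neL neR sL cL aL gL tp inv'.
have col := additive_collinear _ a b aD bD nab.
move/eqP in a1; move/eqP in b2.
have b1 : b g1 != 0.
  apply/eqP => b1; have := col g1 g2; rewrite b1 mulr0 => /eqP.
  by rewrite mulf_eq0 (negbTE a1) (negbTE b2).
(* Opposite signs are excluded by [nab] at [g1] or at [- g1]. *)
have ab : 0 < a g1 / b g1.
  have opp (c : Gam -> R) : (forall g h, c (g + h) = c g + c h) -> c (- g1) = - c g1.
    move=> cD; have := cD g1 (- g1); rewrite subrr.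
    by have := cD 0 0; rewrite addr0; lra.
  have := nab (- g1); have := nab g1; rewrite (opp a aD) (opp b bD) oppr_gt0 oppr_lt0.
  have [A|A|A] := ltgtP (a g1) 0; last by rewrite A eqxx in a1.
  - have [B|B|B] := ltgtP (b g1) 0; last by rewrite B eqxx in b1.
    + by move=> _ _; rewrite nmulr_rgt0// invr_lt0.
    + by move=> _ []; split.
  - have [B|B|B] := ltgtP (b g1) 0; last by rewrite B eqxx in b1.
    + by move=> []; split.
    + by move=> _ _; rewrite divr_gt0.
(* Rescaling by [s * s] turns [b g] into [a g1 / b g1 * b g], which is [a g] by collinearity. *)
pose s : R := sqrt (a g1 / b g1).
have ss : s * s = a g1 / b g1 by apply: sqrt_sqrt; apply/RleP; exact: ltW.
have s0 : s != 0 by apply/eqP => s0; move: ab; rewrite -ss s0 mulr0 ltxx.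
have [dS _] := conjm_diag_expH s 0 s0.
right; right; exists P, (mk s 0 0 s^-1 *m Q); split=> //; split.
  by rewrite det_mulmx dS dQ mulr1.
left=> g; exists (a g); split=> //.
rewrite -conjm_conjm//; apply: psl_trans (conjm_psl _ _ _ (hb g)) _.
rewrite (conjm_diag_expH s (b g) s0).2 ss; left; congr (expH _).
by rewrite mulrAC (col g1 g) -mulrA mulfV// mulr1.
Qed.

Theorem mainTheorem7 (Gam : zmodType) (rL rR : Gam -> Mat) :
  torsion_free Gam ->
  is_psl_rep rL -> is_psl_rep rR ->
  faithful_rep rL rR ->
  (admissible rL rR <->
   ((in_model rL rR inAhyp \/ in_model rL rR inAext \/ in_model rL rR inApar)
    /\ discrete_image rL rR)).
Proof.
move=> tf hL hR fa; split=> [adm|[model di]]; last exact: admissible_of_model.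
by split; [exact: model_of_admissible|have [_ []] := adm].
Qed.
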